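(* In the constant-gain linear setting of the context, with $h$ polynomial and all constraint data polynomial, let $d'_1,\ldots,d'_m$ be the relative degrees of the $m$ HOSCBF constraints and let $s=3m+m^2+\sum_{j=1}^m(d'_j+1)$. The following are equivalent: (a) for all $\hat x_1,\ldots,\hat x_m$ with $\hat h^{d_j}(\hat x_j)\ge0$ for all $j$ and all $0\le d_j\le d'_j$ and with $\|\hat x_j-\hat x_k\|_2\le\gamma$ for all $j,k$, there exists $u\in\mathbb R^p$ satisfying the set of $m$ HOSCBF constraints $A(\hat x)u\le\Xi(\hat x)$; (b) there exist polynomials $\rho^0_{i,j}$, sum-of-squares polynomials $q_S$ ($S\subseteq\{1,\ldots,s\}$), all in the variables $(\hat x_1,\ldots,\hat x_m,y,z_1,\ldots,z_m)$ with $y\in\mathbb R^m$, $\hat x_j,z_j\in\mathbb R^n$, and nonnegative integers $r_1,\ldots,r_m$ such that $\phi+\chi+\psi=0$ identically, where $$\phi=\sum_{S\subseteq\{1,\ldots,s\}}q_S\prod_{i\in S}\phi_i,\qquad \chi=\prod_{j=1}^m\left(-\Xi^T(\hat x)y\right)^{2r_j},\qquad \psi=\sum_{j=1}^m\sum_{i=1}^p\rho^0_{i,j}\left[A^T(\hat x)y\right]_i,$$ and the $\phi_i$ are: $\phi_1,\ldots,\phi_m$ equal to $-\Xi^T(\hat x)y$; $\phi_{m+1},\ldots,\phi_{2m}$ equal to $y_j$ $(j=1,\ldots,m)$; $\phi_{2m+1},\ldots,\phi_{3m}$ equal to $-z_j^Tz_j+\gamma^2$ $(j=1,\ldots,m)$;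 $\phi_{3m+1},\ldots,\phi_{3m+m^2}$ equal to $-(\hat x_j-\hat x_k)^T(\hat x_j-\hat x_k)+\gamma^2$ $(j,k\in\{1,\ldots,m\})$; and the remaining ones equal to $\hat h^{d_j}(\hat x_j)$ for $d_j\in\{0,\ldots,d'_j\}$, $j=1,\ldots,m$.
   Context: System: $dx=(f(x)+g(x)u)\,dt+\sigma\,dW$, with output corrupted by one of $m$ possible sensor faults, $dy=(cx+a)\,dt+\nu\,dV$, $x\in\mathbb R^n$, $u\in\mathbb R^p$, $f(x)=Fx$, $g(x)=G$, constant noise matrices $\sigma,\nu$, $R=\nu\nu^T$, and constant steady-state Kalman gain $K=Pc^TR^{-1}$ ($P$ the steady-state error covariance). $\overline f(x,u)=f(x)+g(x)u$. Safe region $\mathcal C=\{h\ge0\}$. $\hat x_j$ denotes the estimate of the $j$-th estimator (the one omitting the sensors affected by fault $j$). Functions: $h^0=h$, $h^{d+1}=\frac{\partial h^d}{\partial x}\overline f(x,u)+\frac12\mathrm{tr}(\sigma^T\frac{\partial^2h^d}{\partial x^2}\sigma)+h^d$; $d'_j$ is such that $\frac{\partial h^{d'_j}}{\partial x}g(x)\ne0$ for the $j$-th constraint. For $\gamma>0$: $\overline h^d_\gamma=\sup\{h^d(x):\|x-x^{d,0}\|_2\le\gamma,\ h^d(x^{d,0})=0\}$, $\hat h^d=h^d-\overline h^d_\gamma$. For $\gamma_1,\ldots,\gamma_m>0$: $\hat h_j^d=h^d-\overline h^d_{\gamma_j}$. Constraint data, for $\hat x=(\hat x_1,\ldots,\hat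 x_m)$: $A(\hat x)\in\mathbb R^{m\times p}$ has $j$-th row $-\frac{\partial h^{d'_j}}{\partial x}(\hat x_j)g(\hat x_j)$, and $\Xi(\hat x)=[\xi_1(\hat x_1),\ldots,\xi_m(\hat x_m)]^T$ with $$\xi_j(\hat x)=\frac{\partial h^{d'_j}}{\partial x}f(\hat x)+\frac12\mathrm{tr}\left(\nu^TK^T\frac{\partial^2h^{d'_j}}{\partial x^2}(\hat x)K\nu\right)-\left\|\frac{\partial h^{d'_j}}{\partial x}(\hat x)Kc\right\|_2\gamma_j+\hat h_j^{d'_j}(\hat x).$$ *)

(* Defs.v *)
From mathcomp Require Import all_boot all_order all_algebra.
From mathcomp Require Import classical_sets reals.
From mathcomp Require Import mpoly.

Set Implicit Arguments.
Unset Strict Implicit.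
Unset Printing Implicit Defensive.

Import Order.TTheory GRing.Theory Num.Theory.
Local Open Scope classical_set_scope.
Local Open Scope ring_scope.

Definition norm2 (R : realType) (n : nat) (v : 'cV[R]_n) : R :=
  Num.sqrt (\sum_i v i 0 ^+ 2).

Definition mxC (R : realType) (n a b : nat) (M : 'M[R]_(a, b)) :
    'M[{mpoly R[n]}]_(a, b) := map_mx (@mpolyC n R) M.

Definition peval (R : realType) (n : nat) (p : {mpoly R[n]}) (x : 'cV[R]_n) : R :=
  p.@[fun i => x i 0].

Definition mxeval (R : realType) (n a b : nat) (M : 'M[{mpoly R[n]}]_(a, b))
    (x : 'cV[R]_n) : 'M[R]_(a, b) := map_mx (fun p => peval p x) M.

Definition grad (R : realType) (n : nat) (p : {mpoly R[n]}) :
    'rV[{mpoly R[n]}]_n := \row_i p^`M(i).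

Definition hess (R : realType) (n : nat) (p : {mpoly R[n]}) :
    'M[{mpoly R[n]}]_n := \matrix_(i, j) (p^`M(i))^`M(j).

Definition xvec (R : realType) (n : nat) : 'cV[{mpoly R[n]}]_n := \col_i 'X_i.

Section System.
Variables (R : realType) (n p : nat).

(* [hseq F G sigma h u d] is h^d as a polynomial in x, the input u being held
   constant; see [hseq_indep] for the dependence on u. *)
Fixpoint hseq (w : nat) (F : 'M[R]_n) (G : 'M[R]_(n, p)) (sigma : 'M[R]_(n, w))
    (h : {mpoly R[n]}) (u : 'cV[R]_p) (d : nat) : {mpoly R[n]} :=
  if d is d1.+1 then
    let hd := hseq F G sigma h u d1 in
    (grad hd *m (mxC n F *m xvec R n + mxC n (G *m u))) 0 0
    + (2%:R^-1 : R) *: \tr ((mxC n sigma)^T *m hess hd *m mxC n sigma)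
    + hd
  else h.

(* The gradient of h^d along G vanishes identically for d < d' and is not
   identically zero for d = d'. *)
Definition relative_degree (w : nat) (F : 'M[R]_n) (G : 'M[R]_(n, p))
    (sigma : 'M[R]_(n, w)) (h : {mpoly R[n]}) (d' : nat) : Prop :=
  (forall (u : 'cV[R]_p) (d : nat), (d < d')%N ->
     grad (hseq F G sigma h u d) *m mxC n G = 0) /\
  (forall u : 'cV[R]_p, grad (hseq F G sigma h u d') *m mxC n G <> 0).

(* Up to the relative degree h^d does not depend on u, so it is the
   polynomial obtained at u = 0. *)
Definition hd (w : nat) (F : 'M[R]_n) (G : 'M[R]_(n, p)) (sigma : 'M[R]_(n, w))
    (h : {mpoly R[n]}) (d : nat) : {mpoly R[n]} := hseq F G sigma h 0 d.

Lemma hseq_indep (w : nat) (F : 'M[R]_n) (G : 'M[R]_(n, p))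
    (sigma : 'M[R]_(n, w)) (h : {mpoly R[n]}) (d' : nat) :
  relative_degree F G sigma h d' ->
  forall (u : 'cV[R]_p) (d : nat), (d <= d')%N ->
    hseq F G sigma h u d = hd F G sigma h d.
Proof.
move=> [hz _] u; rewrite /hd; elim=> [|d IHd] //= lt_dd'.
have -> := IHd (ltnW lt_dd').
rewrite /mxC !map_mxM !mulmxDr !(mulmxA (grad _)).
by rewrite (hz 0 d lt_dd') !mul0mx.
Qed.

(* hbar^d_gamma is the supremum over both x and its reference point x0. *)
Definition hbar_set (q : {mpoly R[n]}) (gamma : R) : set R :=
  [set r | exists x x0 : 'cV[R]_n,
     [/\ norm2 (x - x0) <= gamma, peval q x0 = 0 & r = peval q x]].

(* Meaningful only when [has_sup (hbar_set q gamma)]: the library's [sup]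
   is 0 on empty or unbounded sets. *)
Definition hbar (q : {mpoly R[n]}) (gamma : R) : R := sup (hbar_set q gamma).

Definition hhat (q : {mpoly R[n]}) (gamma : R) : {mpoly R[n]} :=
  q - (hbar q gamma)%:MP.

(* P is a stationary point of the Riccati equation
   dP/dt = F P + P F^T + sigma sigma^T - P c^T (nu nu^T)^-1 c P
   and is a covariance matrix. *)
Definition steady_state_covariance (k w v : nat) (F : 'M[R]_n)
    (c : 'M[R]_(k, n)) (sigma : 'M[R]_(n, w)) (nu : 'M[R]_(k, v))
    (P : 'M[R]_n) : Prop :=
  [/\ P^T = P,
      (forall x : 'cV[R]_n, 0 <= (x^T *m P *m x) 0 0) &
      F *m P + P *m F^T + sigma *m sigma^T
        - P *m c^T *m invmx (nu *m nu^T) *m c *m P = 0].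

Definition kalman_gain (k v : nat) (c : 'M[R]_(k, n)) (nu : 'M[R]_(k, v))
    (P : 'M[R]_n) : 'M[R]_(n, k) := P *m c^T *m invmx (nu *m nu^T).

Definition Arow (G : 'M[R]_(n, p)) (q : {mpoly R[n]}) :
    'rV[{mpoly R[n]}]_p := - (grad q *m mxC n G).

Definition xi_fun (k v : nat) (F : 'M[R]_n) (c : 'M[R]_(k, n))
    (nu : 'M[R]_(k, v)) (K : 'M[R]_(n, k)) (q : {mpoly R[n]}) (gammaj : R)
    (x : 'cV[R]_n) : R :=
  (mxeval (grad q) x *m (F *m x)) 0 0
  + 2%:R^-1 * \tr (nu^T *m K^T *m mxeval (hess q) x *m K *m nu)
  - norm2 (mxeval (grad q) x *m K *m c)^T * gammaj
  + peval (hhat q gammaj) x.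

End System.

Definition sos (R : realType) (N : nat) (q : {mpoly R[N]}) : Prop :=
  exists l : seq {mpoly R[N]}, q = \sum_(t <- l) t ^+ 2.

(* Variables (xhat_1, ..., xhat_m, y, z_1, ..., z_m), in this order. *)
Definition nvars (m n : nat) : nat := (m * n + m + m * n)%N.

Section Certificate.
Variables (R : realType) (m n p : nat).
Notation poly := {mpoly R[nvars m n]}.

Definition Xhat (j : 'I_m) : 'cV[poly]_n :=
  \col_i 'X_(lshift (m * n) (lshift m (mxvec_index j i))).
Definition Yvar : 'cV[poly]_m := \col_j 'X_(lshift (m * n) (rshift (m * n) j)).
Definition Zvar (j : 'I_m) : 'cV[poly]_n :=
  \col_i 'X_(rshift (m * n + m) (mxvec_index j i)).

Definition at_xhat (j : 'I_m) (q : {mpoly R[n]}) : poly :=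
  q \mPo [tuple Xhat j i 0 | i < n].

(* A(xhat), given its rows A_j(xhat_j). *)
Definition Apoly (A : 'I_m -> 'rV[{mpoly R[n]}]_p) : 'M[poly]_(m, p) :=
  \matrix_(j, i) at_xhat j (A j 0 i).

Definition negXiTy (xi : 'I_m -> {mpoly R[n]}) : poly :=
  - ((\col_j at_xhat j (xi j))^T *m Yvar) 0 0.

Definition nineq (d' : 'I_m -> nat) : nat :=
  (3 * m + m ^ 2 + \sum_(j < m) (d' j + 1))%N.

(* hh d stands for hhat^d. *)
Definition phi_seq (xi : 'I_m -> {mpoly R[n]}) (hh : nat -> {mpoly R[n]})
    (gamma : R) (d' : 'I_m -> nat) : seq poly :=
  nseq m (negXiTy xi)
  ++ [seq Yvar j 0 | j <- enum 'I_m]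
  ++ [seq - ((Zvar j)^T *m Zvar j) 0 0 + (gamma ^+ 2)%:MP | j <- enum 'I_m]
  ++ [seq - ((Xhat j - Xhat k)^T *m (Xhat j - Xhat k)) 0 0 + (gamma ^+ 2)%:MP
       | j <- enum 'I_m, k <- enum 'I_m]
  ++ flatten [seq [seq at_xhat j (hh d) | d <- iota 0 (d' j + 1)]
       | j <- enum 'I_m].

Lemma size_phi_seq xi hh gamma d' : size (phi_seq xi hh gamma d') = nineq d'.
Proof.
have szI : size (enum 'I_m) = m by rewrite size_enum_ord.
have szmap (f : 'I_m -> poly) : size [seq f j | j <- enum 'I_m] = m.
  by rewrite size_map.
rewrite /phi_seq /nineq !size_cat size_nseq size_allpairs !szmap szI.
rewrite size_flatten /shape -map_comp sumnE big_map big_enum /=.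
rewrite (eq_bigr (fun j => d' j + 1)%N) => [|j _]; last first.
  by rewrite size_map size_iota.
by rewrite -mulnn !mulSn mul0n addn0 !addnA.
Qed.

Definition phi (xi : 'I_m -> {mpoly R[n]}) (hh : nat -> {mpoly R[n]})
    (gamma : R) (d' : 'I_m -> nat) (i : 'I_(nineq d')) : poly :=
  nth 0 (phi_seq xi hh gamma d') i.

End Certificate.

(* Main.v *)
(* By Farkas' lemma, A(xhat) u <= Xi(xhat) has no solution u iff some y >= 0 satisfies
   A(xhat)^T y = 0 and Xi(xhat)^T y < 0. Hence (a) says that the system phi_i >= 0, A^T y = 0,
   Xi^T y <> 0 has no real point (the z_j can be taken to be 0), and (b) is the certificate of
   emptiness provided by the Krivine-Stengle Positivstellensatz.

   If there is no certificate, Zorn's lemma gives a prime cone containing the phi_i and the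
   ideal, whose support does not contain Xi^T y; it orders the fraction field of the quotient
   by its support. A maximal cone in an algebraic closure of that field is the nonnegative
   cone of a real closed field, over which the system has a point. This point is moved to R by
   eliminating the variables one at a time (Cohen-Hormander): for a finite family of
   polynomials in one variable closed under derivative, truncation and pseudo-remainder, the
   signs of the leading coefficients determine the sign diagram of the family on the line.

   The algebraic closure is available for countable fields, so the coefficients of the given
   polynomials are treated as additional variables over the integers. *)
Require Import Defs.
From HB Require Import structures.
From mathcomp Require Import all_boot all_order all_algebra all_field.
From mathcomp Require Import boolp classical_sets reals.
From mathcomp Require Import ring zify.
From mathcomp Require Import polyrcf mpoly.
Set Implicit Arguments.
Unset Strict Implicit.
Unset Printing Implicit Defensive.
Import Order.TTheory GRing.Theory Num.Theory.
Local Open Scope ring_scope.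

(** * Farkas' lemma *)

(** The real closed field reached through the cone receives the integer polynomials in the
    coefficients but not [R] itself, so its point cannot be carried to [R] along a map of fields.
    What the two fields share is the sign of every integer polynomial in the coefficients.
    Elimination is therefore stated without formulas, as a comparison of two morphisms from one ring
    to two real closed fields: agreement of signs on a finite set fixed in advance lets each point
    on one side be answered by a point on the other with the same signs. The agreement holds because
    the cone is pulled back from the polynomials over [R], where every nonnegative constant is a
    square. A second obstacle is that [-1] is a square in an algebraically closed field. The cones
    there are only asked to contain the squares of differences of their own elements. *)

Lemma seq_upper_bound (R : realFieldType) (s : seq R) : exists c, {in s, forall x, x < c}.
Proof.
elim: s => [|a s [c cP]]; first by exists 0.
exists (Num.max c (a + 1)) => x; rewrite inE lt_max => /predU1P[->|/cP->//].
by rewrite ltrDl ltr01 orbT.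
Qed.

Lemma seq_lower_bound (R : realFieldType) (s : seq R) : exists c, {in s, forall x, c < x}.
Proof.
have [c cP] := seq_upper_bound (map -%R s).
by exists (- c) => x xs; rewrite ltrNl cP // map_f.
Qed.

Lemma seq_le_separation (R : realFieldType) (L U : seq R) :
  {in L & U, forall l u, l <= u} ->
  exists c, {in L, forall l, l <= c} /\ {in U, forall u, c <= u}.
Proof.
elim: L => [_|a L IHL LU].
  by have [c cP] := seq_lower_bound U; exists c; split=> // u /cP /ltW.
have [l u lL uU|c [Lc cU]] := IHL; first by rewrite LU // inE lL orbT.
exists (Num.max a c); split=> [l|u uU].
  by rewrite inE le_max => /predU1P[->|/Lc->]; rewrite ?lexx ?orbT.
by rewrite ge_max cU // LU ?mem_head.
Qed.

(* Fourier-Motzkin: combining the constraints with weights [fm_weight a t] cancels the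
   coefficients [a] of one variable. *)
Definition fm_weight (R : realFieldType) (I : finType) (a : I -> R) (t : I * I) (i : I) : R :=
  if (0 < a t.1) && (a t.2 < 0) then
    (i == t.1)%:R * - a t.2 + (i == t.2)%:R * a t.1
  else ((t.1 == t.2) && (a t.1 == 0) && (i == t.1))%:R.

Lemma fm_weight_ge0 (R : realFieldType) (I : finType) (a : I -> R) t i :
  0 <= fm_weight a t i.
Proof.
rewrite /fm_weight; case: ifP => [/andP[pa na]|_]; last by rewrite ler0n.
by rewrite addr_ge0 // mulr_ge0 ?ler0n // ?oppr_ge0 ltW.
Qed.

Lemma fm_weight_pair (R : realFieldType) (I : finType) (a : I -> R) i l (f : I -> R) :
  0 < a i -> a l < 0 ->
  \sum_k fm_weight a (i, l) k * f k = - a l * f i + a i * f l.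
Proof.
move=> pi nl.
under eq_bigr => k _ do rewrite /fm_weight /= pi nl /= mulrDl.
rewrite big_split /=; congr (_ + _); [rewrite (bigD1 i)|rewrite (bigD1 l)] => //=;
  rewrite eqxx mul1r big1 ?addr0 // => k /negPf ->; by rewrite !mul0r.
Qed.

(** Constraints free of the eliminated variable survive at the diagonal pairs. A pair that is
    neither of this kind nor of opposite signs has zero weights and gives the void constraint
    [0 <= 0]. *)
Lemma fm_weight_diag (R : realFieldType) (I : finType) (a : I -> R) i (f : I -> R) :
  a i = 0 -> \sum_k fm_weight a (i, i) k * f k = f i.
Proof.
move=> ai0; rewrite (bigD1 i) //= big1 => [|k /negPf ki].
  by rewrite /fm_weight /= ai0 ltxx !eqxx mul1r addr0.
by rewrite /fm_weight /= ai0 ltxx ki !andbF mul0r.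
Qed.

Lemma fm_weight_kill (R : realFieldType) (I : finType) (a : I -> R) t :
  \sum_k fm_weight a t k * a k = 0.
Proof.
case: t => i l; case: (boolP ((0 < a i) && (a l < 0))) => [/andP[pi nl]|H].
  by rewrite fm_weight_pair //; ring.
rewrite big1 // => k _; rewrite /fm_weight /= (negPf H).
by case: eqP => [_|]; case: eqP => [ai|]; case: eqP => [->|]; rewrite ?mul0r //= ai mulr0.
Qed.

(** Induction on the number of unknowns, for every finite index type because elimination replaces
    [I] by [I * I]. A multiplier [y] of the reduced system pulls back to [\sum_t y t * w t i], which
    also annihilates the first column by [fm_weight_kill]. *)
Lemma farkas (R : realFieldType) (p : nat) (I : finType)
    (a : I -> 'I_p -> R) (b : I -> R) :
  (forall y : I -> R, (forall i, 0 <= y i) ->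
     (forall j, \sum_i y i * a i j = 0) -> 0 <= \sum_i y i * b i) ->
  exists u : 'I_p -> R, forall i, \sum_j a i j * u j <= b i.
Proof.
elim: p I a b => [|p IHp] I a b yP.
  exists (fun=> 0) => i; rewrite big_ord0.
  have := yP (fun k => (k == i)%:R) (fun k => ler0n _ _).
  rewrite (bigD1 i) //= eqxx mul1r big1 ?addr0 => [|k /negPf ->]; last by rewrite mul0r.
  by apply=> -[].
pose w := fm_weight (a ^~ ord0).
have [y y0 ya|u uP] := IHp _ (fun t j => \sum_i w t i * a i (lift ord0 j))
                        (fun t => \sum_i w t i * b i).
  have swap (f : I -> R) : \sum_t y t * (\sum_i w t i * f i)
      = \sum_i (\sum_t y t * w t i) * f i.
    under eq_bigr do rewrite mulr_sumr.
    rewrite exchange_big /=; apply: eq_bigr => i _.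
    by rewrite mulr_suml; apply: eq_bigr => t _; rewrite mulrA.
  rewrite swap; apply: yP => [i|j].
    by apply: sumr_ge0 => t _; rewrite mulr_ge0 // fm_weight_ge0.
  rewrite -swap; case: (unliftP ord0 j) => [k ->|->]; first exact: ya.
  by rewrite big1 // => t _; rewrite fm_weight_kill mulr0.
pose rest i := b i - \sum_j a i (lift ord0 j) * u j.
have wrest t : 0 <= \sum_i w t i * rest i.
  rewrite /rest; under eq_bigr do rewrite mulrBr.
  rewrite sumrB subr_ge0; apply: le_trans (uP t).
  rewrite le_eqVlt; apply/orP; left; apply/eqP.
  under eq_bigr do rewrite mulr_sumr.
  rewrite exchange_big /=; apply: eq_bigr => j _.
  by rewrite mulr_suml; apply: eq_bigr => i _; rewrite mulrA.
(* The bound that constraint [i] puts on the first unknown: a lower one if [a i ord0 < 0], an upper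
   one if [0 < a i ord0]. The combination of index [(k, i)] is [q i <= q k] with denominators
   cleared. *)
pose q i := rest i / a i ord0.
have [l r /mapP[i] |c [lc cr]] :=
    @seq_le_separation _ [seq q i | i <- enum I & a i ord0 < 0]
                         [seq q i | i <- enum I & 0 < a i ord0].
  rewrite mem_filter => /andP[ni _] -> /mapP[k]; rewrite mem_filter => /andP[pk _] ->.
  have := wrest (k, i); rewrite /w fm_weight_pair // => H.
  rewrite /q ler_ndivrMr // mulrAC ler_pdivrMr //.
  by move: H; rewrite mulNr addrC subr_ge0 mulrC [rest i * _]mulrC mulrC.
exists (fun j => if unlift ord0 j is Some k then u k else c) => i.
rewrite big_ord_recl unlift_none.
under eq_bigr do rewrite liftK.
rewrite -lerBrDr -/(rest i).
case: (ltgtP (a i ord0) 0) => [ni|pi|a0].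
- rewrite mulrC -ler_ndivrMr //; apply: lc; apply/mapP; exists i => //.
  by rewrite mem_filter ni mem_enum.
- rewrite mulrC -ler_pdivlMr //; apply: cr; apply/mapP; exists i => //.
  by rewrite mem_filter pi mem_enum.
- by have := wrest (i, i); rewrite /w fm_weight_diag // a0 mul0r.
Qed.

(** * Sign diagrams of univariate polynomials *)

Lemma seq_lt_separation (R : realFieldType) (L U : seq R) :
  {in L & U, forall l u, l < u} ->
  exists c, {in L, forall l, l < c} /\ {in U, forall u, c < u}.
Proof.
elim: L => [_|a L IHL LU].
  by have [c cP] := seq_lower_bound U; exists c.
have {IHL}[l u lL uU|c [Lc cU]] := IHL; first by rewrite LU // inE lL orbT.
have {LU}aU : {in U, forall u, a < u} by move=> u uU; rewrite LU ?mem_head.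
have [d [ad dU]] : exists d, a < d /\ {in U, forall u, d < u}.
  elim: U aU {cU} =>  [_|u U IHU aU]; first by exists (a + 1); rewrite ltrDl ltr01.
  have [v vU|d [ad dU]] := IHU; first by rewrite aU // inE vU orbT.
  have au : a < u by rewrite aU ?mem_head.
  exists (Num.min d ((a + u) / 2)); split=> [|v]; first by rewrite lt_min ad midf_lt.
  rewrite inE gt_min => /predU1P[->|/dU->//].
  by rewrite orbC midf_lt.
exists (Num.max c d); split=> [l|u uU]; last by rewrite gt_max cU ?dU.
by rewrite inE lt_max => /predU1P[->|/Lc->//]; rewrite ad orbT.
Qed.

Section SameSign.
Variables (R1 R2 : realDomainType).
Implicit Types (a : R1) (b : R2).

Lemma same_sgz_lt0 a b : sgz a = sgz b -> (a < 0) = (b < 0).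
Proof. by move=> ab; rewrite -sgz_lt0 ab sgz_lt0. Qed.
Lemma same_sgz_gt0 a b : sgz a = sgz b -> (0 < a) = (0 < b).
Proof. by move=> ab; rewrite -sgz_gt0 ab sgz_gt0. Qed.
Lemma same_sgz_le0 a b : sgz a = sgz b -> (a <= 0) = (b <= 0).
Proof. by move=> ab; rewrite -sgz_le0 ab sgz_le0. Qed.
Lemma same_sgz_ge0 a b : sgz a = sgz b -> (0 <= a) = (0 <= b).
Proof. by move=> ab; rewrite -sgz_ge0 ab sgz_ge0. Qed.
Lemma same_sgz_eq0 a b : sgz a = sgz b -> (a == 0) = (b == 0).
Proof. by move=> ab; rewrite -sgz_eq0 ab sgz_eq0. Qed.

End SameSign.

Section Cell.
Variables (K1 K2 : rcfType).
Implicit Types (f : {poly K1}) (g : {poly K2}).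

(** Strict monotonicity makes a root inside force [f.[l1] < 0 < f.[r1]]. These signs carry over to
    [g], and the intermediate value theorem applies. *)
Lemma cell_root_pos f g l1 r1 l2 r2 x :
  {in `]l1, r1[, forall t, 0 < f^`().[t]} ->
  {in `]l2, r2[, forall t, 0 < g^`().[t]} -> l2 < r2 ->
  sgz f.[l1] = sgz g.[l2] -> sgz f.[r1] = sgz g.[r2] ->
  x \in `]l1, r1[ -> root f x -> exists2 y, y \in `]l2, r2[ & root g y.
Proof.
move=> fp gp lr2 sl sr xi /eqP fx0.
have /= : f.[l1] < f.[x] by apply: (derpr fp); rewrite in_itv /= !(itvP xi).
have /= : f.[x] < f.[r1] by apply: (derpl fp); rewrite in_itv /= !(itvP xi).
rewrite fx0 (same_sgz_gt0 sr) (same_sgz_lt0 sl) => gr gl.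
have [||y yi gy] := @poly_ivtoo _ g l2 r2; first exact: ltW.
  by rewrite nmulr_rlt0.
by exists y.
Qed.

(** End signs fix the sign of an increasing function inside, unless they are opposite. In that case
    it is the sign of the distance to the unique root, which the last hypothesis compares on both
    sides. *)
Lemma cell_sign_pos f g l1 r1 l2 r2 x y :
  {in `]l1, r1[, forall t, 0 < f^`().[t]} ->
  {in `]l2, r2[, forall t, 0 < g^`().[t]} ->
  sgz f.[l1] = sgz g.[l2] -> sgz f.[r1] = sgz g.[r2] ->
  x \in `]l1, r1[ -> y \in `]l2, r2[ ->
  {in `]l1, r1[ & `]l2, r2[, forall x0 y0, root f x0 -> root g y0 ->
     sgz (x - x0) = sgz (y - y0)} ->
  sgz f.[x] = sgz g.[y].
Proof.
move=> fp gp sl sr xi yi xy.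
have flx : f.[l1] < f.[x] by apply: (derpr fp); rewrite in_itv /= !(itvP xi).
have fxr : f.[x] < f.[r1] by apply: (derpl fp); rewrite in_itv /= !(itvP xi).
have gly : g.[l2] < g.[y] by apply: (derpr gp); rewrite in_itv /= !(itvP yi).
have gyr : g.[y] < g.[r2] by apply: (derpl gp); rewrite in_itv /= !(itvP yi).
have [fl0|fl0] := leP 0 f.[l1].
  have gl0 := fl0; rewrite (same_sgz_ge0 sl) in gl0.
  by rewrite !gtr0_sgz ?(le_lt_trans gl0 gly) ?(le_lt_trans fl0 flx).
have [fr0|fr0] := leP f.[r1] 0.
  have gr0 := fr0; rewrite (same_sgz_le0 sr) in gr0.
  by rewrite !ltr0_sgz ?(lt_le_trans gyr gr0) ?(lt_le_trans fxr fr0).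
have gl0 := fl0; rewrite (same_sgz_lt0 sl) in gl0.
have gr0 := fr0; rewrite (same_sgz_gt0 sr) in gr0.
have lr1 : l1 <= r1 by rewrite !(itvP xi).
have lr2 : l2 <= r2 by rewrite !(itvP yi).
have [|x0 x0i fx0] := poly_ivtoo lr1 (p := f); first by rewrite nmulr_rlt0.
have [|y0 y0i gy0] := poly_ivtoo lr2 (p := g); first by rewrite nmulr_rlt0.
have sub (K : rcfType) (a b : K) : {subset `]a, b[ <= `[a, b]}.
  by move=> t ti; rewrite in_itv /= !(itvP ti).
have key (K : rcfType) (a b : K) (h : {poly K}) (t t0 : K) :
    {in `]a, b[, forall t, 0 < h^`().[t]} -> t \in `]a, b[ -> t0 \in `]a, b[ ->
    root h t0 -> sgz h.[t] = sgz (t - t0).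
  move=> hp ti t0i /eqP ht0; case: (ltgtP t t0) => [lt|gt|->]; last by rewrite ht0 subrr !sgz0.
    have := lt; rewrite -(ltr_horner hp) ?sub // ht0 => h0.
    by rewrite !ltr0_sgz // subr_lt0.
  have := gt; rewrite -(ltr_horner hp) ?sub // ht0 => h0.
  by rewrite !gtr0_sgz // subr_gt0.
by rewrite (key _ _ _ _ _ _ fp xi x0i fx0) (key _ _ _ _ _ _ gp yi y0i gy0); exact: xy.
Qed.

Variables (f : {poly K1}) (g : {poly K2}) (l1 r1 : K1) (l2 r2 : K2) (e : int).
Hypothesis fs : {in `]l1, r1[, forall t, sgz f^`().[t] = e}.
Hypothesis gs : {in `]l2, r2[, forall t, sgz g^`().[t] = e}.
Hypothesis sl : sgz f.[l1] = sgz g.[l2].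
Hypothesis sr : sgz f.[r1] = sgz g.[r2].

Let sgz_gt (K : realDomainType) (a : K) : sgz a = 1 -> 0 < a.
Proof. by move=> a1; rewrite -sgz_gt0 a1. Qed.

Let sgz_lt (K : realDomainType) (a : K) : sgz a = -1 -> 0 < - a.
Proof. by move=> a1; rewrite oppr_gt0 -sgz_lt0 a1. Qed.

Lemma cell_root x : e != 0 -> l2 < r2 -> x \in `]l1, r1[ -> root f x ->
  exists2 y, y \in `]l2, r2[ & root g y.
Proof.
move=> e0 lr2 xi fx.
have /orP[/eqP e1|/eqP e1] : (e == 1) || (e == -1).
- move: e0; rewrite -(fs xi); case: (sgzP (f^`().[x])) => //.
- apply: (@cell_root_pos f g _ _ _ _ x _ _ lr2 sl sr xi fx) => t ti.
    by apply: sgz_gt; rewrite fs.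
  by apply: sgz_gt; rewrite gs.
have [|||||||y yi] := @cell_root_pos (- f) (- g) l1 r1 l2 r2 x; rewrite ?rootN //.
- by move=> t ti; rewrite derivN hornerN; apply: sgz_lt; rewrite fs.
- by move=> t ti; rewrite derivN hornerN; apply: sgz_lt; rewrite gs.
- by rewrite !hornerN !sgzN sl.
- by rewrite !hornerN !sgzN sr.
by exists y.
Qed.

Lemma cell_sign x y : e != 0 -> x \in `]l1, r1[ -> y \in `]l2, r2[ ->
  {in `]l1, r1[ & `]l2, r2[, forall x0 y0, root f x0 -> root g y0 ->
     sgz (x - x0) = sgz (y - y0)} ->
  sgz f.[x] = sgz g.[y].
Proof.
move=> e0 xi yi xy.
have /orP[/eqP e1|/eqP e1] : (e == 1) || (e == -1).
- move: e0; rewrite -(fs xi); case: (sgzP (f^`().[x])) => //.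
- apply: (cell_sign_pos _ _ sl sr xi yi xy) => t ti.
    by apply: sgz_gt; rewrite fs.
  by apply: sgz_gt; rewrite gs.
apply: oppr_inj; rewrite -!sgzN -!hornerN.
apply: (@cell_sign_pos (- f) (- g) l1 r1 l2 r2) => //.
- by move=> t ti; rewrite derivN hornerN; apply: sgz_lt; rewrite fs.
- by move=> t ti; rewrite derivN hornerN; apply: sgz_lt; rewrite gs.
- by rewrite !hornerN !sgzN sl.
- by rewrite !hornerN !sgzN sr.
by move=> x0 y0 x0i y0i; rewrite !rootN; apply: xy.
Qed.

End Cell.

Lemma deriv_neq0 (R : numDomainType) (f : {poly R}) : (1 < size f)%N -> f^`() != 0.
Proof.
move=> szf; apply/eqP => /polyP /(_ (size f).-2); rewrite coef_deriv coef0 => /eqP.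
rewrite prednK ?ltn_predRL // mulrn_eq0 -lead_coefE lead_coef_eq0 -size_poly_eq0.
by case: (size f) szf => [|[]].
Qed.

Section Diagram.
Variables (K1 K2 : rcfType).
Implicit Types (s : seq (K1 * K2)) (Q : seq ({poly K1} * {poly K2})).

(* The pairs in [s] match points of the two lines in the same order; [same_cell s x y] says
   that [x] and [y] are the two components of one pair or lie in corresponding gaps. *)
Definition same_cell s (x : K1) (y : K2) : Prop :=
  {in s, forall u, sgz (x - u.1) = sgz (y - u.2)}.

(** The list is neither sorted nor free of repetitions: the first field makes the pairing an order
    isomorphism. Matched points need not be roots, but every root of a nonzero member is matched. *)
Record diagram s Q : Prop := Diagram {
  diagram_order : {in s, forall u, same_cell s u.1 u.2};
  diagram_sign : forall x y, same_cell s x y ->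
    {in Q, forall q, sgz q.1.[x] = sgz q.2.[y]};
  diagram_root1 : {in Q, forall q, q.1 != 0 -> forall x, root q.1 x ->
    exists2 u, u \in s & u.1 = x};
  diagram_root2 : {in Q, forall q, q.2 != 0 -> forall y, root q.2 y ->
    exists2 u, u \in s & u.2 = y} }.

Lemma same_cell_eq s x y u : same_cell s x y -> u \in s -> (x == u.1) = (y == u.2).
Proof. by move=> xy us; rewrite -subr_eq0 (same_sgz_eq0 (xy u us)) subr_eq0. Qed.

Lemma same_cell_lt s x y u : same_cell s x y -> u \in s -> (x < u.1) = (y < u.2).
Proof. by move=> xy us; rewrite -subr_lt0 (same_sgz_lt0 (xy u us)) subr_lt0. Qed.

Lemma same_cell_gt s x y u : same_cell s x y -> u \in s -> (u.1 < x) = (u.2 < y).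
Proof. by move=> xy us; rewrite -subr_gt0 (same_sgz_gt0 (xy u us)) subr_gt0. Qed.

Lemma same_cellP s x y :
  {in s, forall u, (x < u.1) = (y < u.2)} -> {in s, forall u, (u.1 < x) = (u.2 < y)} ->
  same_cell s x y.
Proof.
move=> lt gt u us; case: (ltgtP x u.1) => [xu|xu|xu].
- by rewrite !ltr0_sgz // subr_lt0 // -lt.
- by rewrite !gtr0_sgz // subr_gt0 // -gt.
- have /eqP -> : y == u.2 by rewrite eq_le !leNgt -lt // -gt // xu !ltxx.
  by rewrite xu !subrr !sgz0.
Qed.

(** An unmatched [x] is answered by density: the partners of the points below [x] lie below the
    partners of the points above it. *)
Lemma same_cell_exists s x : {in s, forall u, same_cell s u.1 u.2} ->
  exists y, same_cell s x y.
Proof.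
move=> os; have [/hasP[u us /eqP ux]|nx] := boolP (has (fun u => u.1 == x) s).
  by exists u.2; rewrite -ux; apply: os.
have [l r /mapP[u] |c [lc cr]] :=
    @seq_lt_separation _ [seq u.2 | u <- s & u.1 < x] [seq u.2 | u <- s & x < u.1].
  rewrite mem_filter => /andP[ux us] -> /mapP[v]; rewrite mem_filter => /andP[xv vs] ->.
  by rewrite -(same_cell_lt (os u us) vs) (lt_trans ux xv).
exists c; apply: same_cellP => u us; apply/idP/idP => [xu|].
- by apply: cr; apply/mapP; exists u; rewrite // mem_filter xu.
- apply: contraTT; rewrite -leNgt le_eqVlt => /predU1P[ux|ux].
    by case/negP: nx; apply/hasP; exists u => //; rewrite ux.
  by rewrite -leNgt ltW // lc //; apply/mapP; exists u; rewrite // mem_filter ux.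
- by apply: lc; apply/mapP; exists u; rewrite // mem_filter xu.
- apply: contraTT; rewrite -leNgt le_eqVlt => /predU1P[ux|ux].
    by case/negP: nx; apply/hasP; exists u => //; rewrite ux.
  by rewrite -leNgt ltW // cr //; apply/mapP; exists u; rewrite // mem_filter ux.
Qed.

Lemma exists_max_below s (x : K1) :
  {in s, forall u, x <= u.1} \/
  exists u0, [/\ u0 \in s, u0.1 < x & {in s, forall u, u.1 < x -> u.1 <= u0.1}].
Proof.
elim: s => [|v s [IHs|[u0 [u0s u0x u0max]]]]; first by left.
- have [vx|xv] := ltP v.1 x; last first.
    by left=> u; rewrite inE => /predU1P[->|/IHs].
  right; exists v; rewrite mem_head; split=> // u; rewrite inE => /predU1P[->//|/IHs xu].
  by rewrite ltNge xu.
- right; have [/andP[vx uv]|nv] := boolP ((v.1 < x) && (u0.1 < v.1)).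
    exists v; rewrite mem_head; split=> // u; rewrite inE => /predU1P[->//|us ux].
    exact: le_trans (u0max u us ux) (ltW uv).
  exists u0; rewrite inE u0s orbT; split=> // u; rewrite inE => /predU1P[-> vx|]; last exact: u0max.
  by move: nv; rewrite vx /= -leNgt.
Qed.

(** The left end of the gap is the nearest matched point. If there is none, a point beyond the
    Cauchy bound stands for minus infinity, where the sign is determined by the size and the leading
    coefficient; hence the hypotheses on both. *)
Lemma left_witness s (f : {poly K1}) (g : {poly K2}) x y :
  {in s, forall u, same_cell s u.1 u.2} ->
  {in s, forall u, sgz f.[u.1] = sgz g.[u.2]} ->
  f != 0 -> size f = size g -> sgz (lead_coef f) = sgz (lead_coef g) ->
  same_cell s x y -> {in s, forall u, u.1 != x} ->
  exists l1 l2, [/\ l1 < x /\ l2 < y, forall t, l1 < t <= x -> same_cell s t y,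
     forall t, l2 < t <= y -> same_cell s x t & sgz f.[l1] = sgz g.[l2]].
Proof.
move=> os fg f0 szfg lcfg xy nx.
have g0 : g != 0 by rewrite -size_poly_gt0 -szfg size_poly_gt0.
have x_gt u : u \in s -> x <= u.1 -> x < u.1.
  by move=> us; rewrite le_eqVlt => /predU1P[xu|//]; have := nx u us; rewrite xu eqxx.
have [xs|[u0 [u0s u0x u0max]]] := exists_max_below s x.
  have inf (K : rcfType) (h : {poly K}) (z : K) : h != 0 ->
      exists2 l, l < z & sgz h.[l] = (-1) ^+ (size h).-1 * sgz (lead_coef h).
    move=> h0; exists (Num.min (z - 1) (- cauchy_bound h)).
      by rewrite gt_min ltrBlDr ltrDl ltr01.
    rewrite -sgz_sgr (sgp_minftyP (le_cauchy_bound h0)); last first.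
      by rewrite in_itv /= ge_min lexx orbT.
    by rewrite /sgp_minfty sgz_sgr sgzM sgzX sgzN1.
  have [l1 l1x fl] := inf _ f x f0; have [l2 l2y gl] := inf _ g y g0.
  exists l1, l2; split=> //; last by rewrite fl gl szfg lcfg.
  - move=> t /andP[_ tx] u us; have xu := x_gt u us (xs u us).
    by rewrite -(xy u us) !ltr0_sgz // subr_lt0 // (le_lt_trans tx).
  - move=> t /andP[_ ty] u us; have xu := x_gt u us (xs u us).
    rewrite (xy u us) !ltr0_sgz // subr_lt0 -?(same_cell_lt xy us) // (le_lt_trans ty) //.
    by rewrite -(same_cell_lt xy us).
exists u0.1, u0.2; split; last exact: fg.
- by rewrite u0x -(same_cell_gt xy u0s).
- move=> t /andP[ut tx] u us; rewrite -(xy u us).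
  have [ux|/(x_gt u us) xu] := ltP u.1 x.
    by rewrite !gtr0_sgz // subr_gt0 // (le_lt_trans _ ut) ?u0max.
  by rewrite !ltr0_sgz // subr_lt0 // (le_lt_trans tx).
- move=> t /andP[ut ty] u us; rewrite (xy u us).
  have [ux|/(x_gt u us) xu] := ltP u.1 x.
    have uy := ux; rewrite (same_cell_gt xy us) in uy.
    rewrite !gtr0_sgz // subr_gt0 // (le_lt_trans _ ut) //.
    by rewrite leNgt -(same_cell_lt (os _ u0s) us) -leNgt u0max.
  rewrite (same_cell_lt xy us) in xu.
  by rewrite !ltr0_sgz // subr_lt0 // (le_lt_trans ty).
Qed.

End Diagram.

Section Witness.
Variables (K1 K2 : rcfType).
Implicit Types (s : seq (K1 * K2)) (Q : seq ({poly K1} * {poly K2})).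

Let negs s := [seq (- u.1, - u.2) | u <- s].

Let same_cell_neg s x y : same_cell (negs s) (- x) (- y) <-> same_cell s x y.
Proof.
split=> xy u us.
  have /xy : (- u.1, - u.2) \in negs s by apply/mapP; exists u.
  by rewrite /= -!opprD !sgzN => /oppr_inj.
case/mapP: us => v vs -> /=.
by rewrite -!opprD !sgzN (xy v vs).
Qed.

(** Reflection of [left_witness]: composition with [- 'X] keeps the size and multiplies the leading
    coefficient by a sign that depends on the size alone. *)
Lemma right_witness s (f : {poly K1}) (g : {poly K2}) x y :
  {in s, forall u, same_cell s u.1 u.2} ->
  {in s, forall u, sgz f.[u.1] = sgz g.[u.2]} ->
  f != 0 -> size f = size g -> sgz (lead_coef f) = sgz (lead_coef g) ->
  same_cell s x y -> {in s, forall u, u.1 != x} ->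
  exists r1 r2, [/\ x < r1 /\ y < r2, forall t, x <= t < r1 -> same_cell s t y,
     forall t, y <= t < r2 -> same_cell s x t & sgz f.[r1] = sgz g.[r2]].
Proof.
move=> os fg f0 szfg lcfg xy nx.
have szN (K : rcfType) : size (- 'X : {poly K}) = 2 by rewrite size_polyN size_polyX.
have [] := @left_witness K1 K2 (negs s) (f \Po - 'X) (g \Po - 'X) (- x) (- y).
- by move=> _ /mapP[u us ->] /=; apply/same_cell_neg/os.
- by move=> _ /mapP[u us ->] /=; rewrite !horner_comp !hornerE !opprK fg.
- by rewrite comp_poly_eq0 ?szN.
- by rewrite !size_comp_poly2 ?szN.
- rewrite !lead_coef_comp ?szN // !lead_coefN !lead_coefX !sgzM szfg lcfg.
  by rewrite !sgzX !sgzN1.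
- exact/same_cell_neg.
- by move=> _ /mapP[u us ->] /=; rewrite eqr_opp nx.
move=> l1 [l2 [[l1x l2y] c1 c2 fl]]; exists (- l1), (- l2); split.
- by rewrite ltrNr l1x ltrNr l2y.
- move=> t /andP[xt tl]; apply/same_cell_neg/c1.
  by rewrite lerN2 xt andbT ltrNr.
- move=> t /andP[xt tl]; apply/same_cell_neg/c2.
  by rewrite lerN2 xt andbT ltrNr.
- by move: fl; rewrite !horner_comp !hornerE.
Qed.

(** The roots of the derivatives are matched, so inside a gap both derivatives have one common
    nonzero sign [e]: there [f] and [g] are strictly monotone in the same direction between ends of
    known sign. *)
Lemma cell_frame s Q (f : {poly K1}) (g : {poly K2}) x y :
  diagram s Q -> (f^`(), g^`()) \in Q -> (1 < size f)%N ->
  size f = size g -> sgz (lead_coef f) = sgz (lead_coef g) ->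
  {in s, forall u, sgz f.[u.1] = sgz g.[u.2]} ->
  same_cell s x y -> {in s, forall u, u.1 != x} ->
  exists l1 r1 l2 r2 e,
   [/\ e != 0, (x \in `]l1, r1[) /\ (y \in `]l2, r2[),
       (forall t, t \in `]l1, r1[ -> same_cell s t y) /\
       (forall t, t \in `]l2, r2[ -> same_cell s x t),
       (forall t, t \in `]l1, r1[ -> sgz f^`().[t] = e) /\
       (forall t, t \in `]l2, r2[ -> sgz g^`().[t] = e) &
       (sgz f.[l1] = sgz g.[l2]) /\ (sgz f.[r1] = sgz g.[r2])].
Proof.
move=> D fgQ szf szfg lcfg fg xy nx.
have f0 : f != 0 by rewrite -size_poly_gt0 (ltn_trans _ szf).
have [l1 [l2 [[lx ly] cl1 cl2 fgl]]] := left_witness (diagram_order D) fg f0 szfg lcfg xy nx.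
have [r1 [r2 [[rx ry] cr1 cr2 fgr]]] := right_witness (diagram_order D) fg f0 szfg lcfg xy nx.
have c1 : {in `]l1, r1[, forall t, same_cell s t y}.
  move=> t ti; have [tx|xt] := leP t x; first by apply: cl1; rewrite tx (itvP ti).
  by apply: cr1; rewrite (ltW xt) (itvP ti).
have c2 : {in `]l2, r2[, forall t, same_cell s x t}.
  move=> t ti; have [tx|xt] := leP t y; first by apply: cl2; rewrite tx (itvP ti).
  by apply: cr2; rewrite (ltW xt) (itvP ti).
exists l1, r1, l2, r2, (sgz g^`().[y]); split=> //.
- rewrite sgz_eq0; apply/negP => gy.
  have g'0 : g^`() != 0 by rewrite deriv_neq0 // -szfg.
  have [u us uy] := diagram_root2 D fgQ g'0 gy.
  by have := nx u us; rewrite eq_sym (same_cell_eq xy us) uy eqxx.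
- by rewrite !in_itv /= lx rx ly ry.
- split=> t ti; first exact: diagram_sign D _ _ (c1 t ti) _ fgQ.
  rewrite -(diagram_sign D (c2 t ti) fgQ); exact: diagram_sign D _ _ xy _ fgQ.
Qed.

(** By Rolle, two roots in one gap would enclose a root of the derivative, which is a matched
    point. *)
Lemma cell_root_uniq s Q (f : {poly K1}) (g : {poly K2}) x x' y :
  diagram s Q -> (f^`(), g^`()) \in Q -> (1 < size f)%N ->
  same_cell s x y -> same_cell s x' y -> root f x -> root f x' -> x = x'.
Proof.
move=> D fgQ szf; wlog xx' : x x' / x < x' => [H|] xy x'y /eqP fx /eqP fx'.
  case: (ltgtP x x') => // lt; first by apply: H => //; apply/eqP.
  by apply/esym/H => //; apply/eqP.
have f'0 := deriv_neq0 szf.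
have [|t ti /eqP ft] := poly_rolle xx' (p := f); first by rewrite fx fx'.
have [u us ut] := diagram_root1 D fgQ f'0 ft.
have := same_cell_lt xy us; have := same_cell_lt x'y us.
by rewrite ut !(itvP ti) => <-.
Qed.

Lemma cell_root_transfer s Q (f : {poly K1}) (g : {poly K2}) x :
  diagram s Q -> (f^`(), g^`()) \in Q -> (1 < size f)%N ->
  size f = size g -> sgz (lead_coef f) = sgz (lead_coef g) ->
  {in s, forall u, sgz f.[u.1] = sgz g.[u.2]} ->
  {in s, forall u, u.1 != x} -> root f x ->
  exists2 y, same_cell s x y & root g y.
Proof.
move=> D fgQ szf szfg lcfg fg nx fx.
have [y xy] := same_cell_exists x (diagram_order D).
have [l1 [r1 [l2 [r2 [e [e0 [xi yi] [c1 c2] [fe ge] [sl sr]]]]]]] :=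
  cell_frame D fgQ szf szfg lcfg fg xy nx.
have [|y0 y0i gy0] := cell_root fe ge sl sr e0 _ xi fx; first by rewrite !(itvP yi).
by exists y0 => //; apply: c2.
Qed.

End Witness.

(** The lemmas above are oriented from the first line to the second; exchanging the lines gives the
    converse ones. *)
Definition swap_all (A B : Type) (s : seq (A * B)) : seq (B * A) :=
  [seq (u.2, u.1) | u <- s].

Lemma mem_swap_all (A B : eqType) (s : seq (A * B)) a b :
  ((b, a) \in swap_all s) = ((a, b) \in s).
Proof.
apply/mapP/idP => [[[a' b'] us /= [-> ->]] //|us]; by exists (a, b).
Qed.

Lemma same_cell_swap (K1 K2 : rcfType) (s : seq (K1 * K2)) x y :
  same_cell s x y -> same_cell (swap_all s) y x.
Proof. by move=> xy _ /mapP[u us ->] /=; rewrite xy. Qed.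

Lemma same_cell_swapK (K1 K2 : rcfType) (s : seq (K1 * K2)) x y :
  same_cell (swap_all s) y x -> same_cell s x y.
Proof. by move=> xy [a b] us; rewrite -(xy (b, a)) // mem_swap_all. Qed.

Lemma diagram_swap (K1 K2 : rcfType) (s : seq (K1 * K2)) Q :
  diagram s Q -> diagram (swap_all s) (swap_all Q).
Proof.
move=> D; split.
- by move=> _ /mapP[u us ->]; apply/same_cell_swap/(diagram_order D).
- move=> x y /same_cell_swapK yx _ /mapP[q qQ ->] /=.
  by rewrite (diagram_sign D yx).
- move=> _ /mapP[q qQ ->] q0 x qx.
  have [u us ux] := diagram_root2 D qQ q0 qx.
  by exists (u.2, u.1) => //; apply/mapP; exists u.
- move=> _ /mapP[q qQ ->] q0 x qx.
  have [u us ux] := diagram_root1 D qQ q0 qx.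
  by exists (u.2, u.1) => //; apply/mapP; exists u.
Qed.

Lemma seq_roots (K : rcfType) (f : {poly K}) : f != 0 ->
  exists rs : seq K, forall x, root f x -> x \in rs.
Proof.
move=> f0; exists (rootsR f) => x fx.
by rewrite -(roots_on_rootsR f0) in_itv fx.
Qed.

Section Step.
Variables (K1 K2 : rcfType).
Implicit Types (s : seq (K1 * K2)) (Q : seq ({poly K1} * {poly K2})).

(** In each gap [f] and [g] are monotone alike with equal end signs, so both have one root there or
    neither has; the new roots are matched to each other. The second conclusion records the origin
    of matched points, from which later signs are computed by pseudo-division. *)
Lemma diagram_step s Q (f : {poly K1}) (g : {poly K2}) :
  diagram s Q -> (f^`(), g^`()) \in Q -> (1 < size f)%N ->
  size f = size g -> sgz (lead_coef f) = sgz (lead_coef g) ->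
  {in s, forall u, sgz f.[u.1] = sgz g.[u.2]} ->
  exists s', diagram s' ((f, g) :: Q) /\ {in s', forall u, u \in s \/ root f u.1}.
Proof.
move=> D fgQ szf szfg lcfg fg.
have szg : (1 < size g)%N by rewrite -szfg.
have f0 : f != 0 by rewrite -size_poly_gt0 (ltn_trans _ szf).
have gfQ : (g^`(), f^`()) \in swap_all Q by rewrite mem_swap_all.
have Dsw := diagram_swap D.
have uniq1 := @cell_root_uniq _ _ s Q f g _ _ _ D fgQ szf.
have uniq2 x y y' : same_cell s x y -> same_cell s x y' -> root g y -> root g y' -> y = y'.
  move=> /same_cell_swap xy /same_cell_swap xy'.
  exact: cell_root_uniq Dsw gfQ szg xy xy'.
have [t [tP tall]] : exists t : seq (K1 * K2),
    {in t, forall v, [/\ root f v.1, root g v.2, {in s, forall u, u.1 != v.1}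
                       & same_cell s v.1 v.2]} /\
    (forall x, root f x -> {in s, forall u, u.1 != x} -> exists2 v, v \in t & v.1 = x).
  have [rs rsP] := seq_roots f0.
  suff [t [tP tall]] : exists t : seq (K1 * K2),
    {in t, forall v, [/\ root f v.1, root g v.2, {in s, forall u, u.1 != v.1}
                       & same_cell s v.1 v.2]} /\
    (forall x, x \in rs -> root f x -> {in s, forall u, u.1 != x} ->
       exists2 v, v \in t & v.1 = x).
    by exists t; split=> // x fx; apply: tall => //; apply: rsP.
  elim: rs {rsP} => [|a rs [t [tP tall]]]; first by exists [::].
  have [/andP[fa /allP na]|nfa] := boolP (root f a && all (fun u => u.1 != a) s).
    have [b ab gb] := cell_root_transfer D fgQ szf szfg lcfg fg na fa.
    exists ((a, b) :: t); split=> [v|x].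
      by rewrite inE => /predU1P[->|/tP//].
    rewrite inE => /predU1P[->|xrs] fx nx; first by exists (a, b); rewrite ?mem_head.
    by have [v vt vx] := tall x xrs fx nx; exists v; rewrite // inE vt orbT.
  exists t; split=> // x; rewrite inE => /predU1P[-> fa na|]; last exact: tall.
  by case/negP: nfa; rewrite fa; apply/allP.
have notin2 x y : same_cell s x y -> {in s, forall u, u.1 != x} -> {in s, forall u, u.2 != y}.
  by move=> xy nx u us; rewrite eq_sym -(same_cell_eq xy us) eq_sym nx.
have notin1 x y : same_cell s x y -> {in s, forall u, u.2 != y} -> {in s, forall u, u.1 != x}.
  by move=> xy nx u us; rewrite eq_sym (same_cell_eq xy us) eq_sym nx.
(* Two distinct roots of f are separated by a matched point: otherwise f^`() would have a root
   between them, which is matched since f^`() belongs to Q. *)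
have ot : {in t &, forall u v, u.1 < v.1 -> u.2 < v.2}.
  move=> u v ut vt uv; have [fu gu nu cu] := tP u ut; have [fv gv nv cv] := tP v vt.
  have [/allP al|/allPn[w ws ww]] :=
      boolP (all (fun w => sgz (u.1 - w.1) == sgz (v.1 - w.1)) s).
    have cuv : same_cell s u.1 v.2 by move=> w ws; rewrite -(cv w ws); apply/eqP/al.
    by move: uv; rewrite (uniq1 _ _ _ cuv cv fu fv) ltxx.
  have uw : u.1 < w.1.
    rewrite lt_neqAle eq_sym nu //= leNgt; apply: contra ww => wu.
    by rewrite !gtr0_sgz // subr_gt0 // (lt_trans wu).
  have wv : w.1 < v.1.
    rewrite lt_neqAle nv //= leNgt; apply: contra ww => vw.
    by rewrite !ltr0_sgz // subr_lt0 // (lt_trans uv).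
  rewrite (same_cell_lt cu ws) in uw; rewrite (same_cell_gt cv ws) in wv.
  exact: lt_trans uw wv.
have et : {in t &, forall u v, u.1 = v.1 -> u.2 = v.2}.
  move=> u v ut vt uv; have [fu gu nu cu] := tP u ut; have [fv gv nv cv] := tP v vt.
  by apply: uniq2 gu gv => //; [exact: cu | rewrite uv].
have os' : {in t ++ s, forall u, same_cell (t ++ s) u.1 u.2}.
  move=> u; rewrite mem_cat => /orP[ut|us] v; rewrite mem_cat => /orP[vt|vs].
  - case: (ltgtP u.1 v.1) => uv.
    + by rewrite !ltr0_sgz // subr_lt0 // ot.
    + by rewrite !gtr0_sgz // subr_gt0 // ot.
    + by rewrite uv (et u v) // !subrr !sgz0.
  - by have [_ _ _] := tP u ut; apply.
  - rewrite -[u.1 - _]opprB -[u.2 - _]opprB !sgzN.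
    by have [_ _ _ ->] := tP v vt.
  - exact: (diagram_order D).
exists (t ++ s); split; last first.
  by move=> u; rewrite mem_cat => /orP[/tP[]|]; [right|left].
have sub x y : same_cell (t ++ s) x y -> same_cell s x y.
  by move=> xy u us; apply: xy; rewrite mem_cat us orbT.
have root1 x : root f x -> exists2 u, u \in t ++ s & u.1 = x.
  move=> fx; have [/hasP[u us /eqP ux]|] := boolP (has (fun u => u.1 == x) s).
    by exists u; rewrite // mem_cat us orbT.
  rewrite -all_predC => /allP nx; have [v vt vx] := tall x fx nx.
  by exists v; rewrite // mem_cat vt.
have root2 y : root g y -> exists2 u, u \in t ++ s & u.2 = y.
  move=> gy; have [/hasP[u us /eqP uy]|] := boolP (has (fun u => u.2 == y) s).
    by exists u; rewrite // mem_cat us orbT.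
  rewrite -all_predC => /allP ny.
  have [||x0 /same_cell_swapK x0y fx0] :=
      cell_root_transfer Dsw gfQ szg (esym szfg) (esym lcfg) _ _ gy.
  - by move=> _ /mapP[u us ->] /=; rewrite fg.
  - by move=> _ /mapP[u us ->] /=; apply: ny.
  have [v vt vx0] := tall x0 fx0 (notin1 _ _ x0y ny).
  exists v; first by rewrite mem_cat vt.
  have [_ gv _ cv] := tP v vt; apply: uniq2 gv gy; first exact: cv.
  by rewrite vx0.
split=> //.
- move=> x y xy' q; rewrite inE => /predU1P[->|]; last exact/diagram_sign/sub.
  have xy := sub _ _ xy'.
  have [/hasP[u us /eqP ux]|] := boolP (has (fun u => u.1 == x) s).
    have /eqP -> : y == u.2 by rewrite -(same_cell_eq xy us) ux.
    by rewrite -ux fg.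
  rewrite -all_predC => /allP nx.
  have [l1 [r1 [l2 [r2 [e [e0 [xi yi] [c1 c2] [fe ge] [sl sr]]]]]]] :=
    cell_frame D fgQ szf szfg lcfg fg xy nx.
  apply: (cell_sign fe ge sl sr e0 xi yi) => x0 y0 x0i y0i fx0 gy0.
  have x0y := c1 _ x0i; have xy0 := c2 _ y0i.
  have [v vt vx0] := tall x0 fx0 (notin1 _ _ x0y (notin2 _ _ xy nx)).
  have [_ gv _ cv] := tP v vt.
  (* [g] has at most one root in the gap, so [y0] is the partner of [x0], and [xy'] compares [x] and
     [y] with that pair. *)
  have <- : v.2 = y0.
    apply: uniq2 gv gy0; first exact: cv.
    by rewrite vx0 => u us; rewrite x0y // -(xy0 _ us) xy.
  by rewrite -vx0; apply: xy'; rewrite mem_cat vt.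
- move=> q; rewrite inE => /predU1P[-> _|qQ q0 x qx]; first exact: root1.
  have [u us ux] := diagram_root1 D qQ q0 qx.
  by exists u; rewrite // mem_cat us orbT.
- move=> q; rewrite inE => /predU1P[-> _|qQ q0 x qx]; first exact: root2.
  have [u us ux] := diagram_root2 D qQ q0 qx.
  by exists u; rewrite // mem_cat us orbT.
Qed.

End Step.

(** * Elimination of one variable *)

Lemma diagram_sub (K1 K2 : rcfType) (s : seq (K1 * K2)) Q Q' :
  {subset Q' <= Q} -> diagram s Q -> diagram s Q'.
Proof.
move=> QQ' D; split.
- exact: diagram_order D.
- by move=> x y xy q /QQ'; apply: diagram_sign D _ _ xy q.
- by move=> q /QQ'; apply: diagram_root1 D q.
- by move=> q /QQ'; apply: diagram_root2 D q.
Qed.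

Lemma diagram_const (K1 K2 : rcfType) (s : seq (K1 * K2)) Q a b :
  sgz a = sgz b -> diagram s Q -> diagram s ((a%:P, b%:P) :: Q).
Proof.
move=> ab D; split.
- exact: diagram_order D.
- move=> x y xy q; rewrite inE => /predU1P[->|]; last exact: diagram_sign D _ _ xy q.
  by rewrite !hornerC.
- move=> q; rewrite inE => /predU1P[->|]; last exact: diagram_root1 D q.
  by rewrite polyC_eq0 => a0 x; rewrite rootC (negPf a0).
- move=> q; rewrite inE => /predU1P[->|]; last exact: diagram_root2 D q.
  by rewrite polyC_eq0 => a0 x; rewrite rootC (negPf a0).
Qed.

Section Closure.
Variable A : comNzRingType.
Implicit Types (p q : {poly A}) (Q : seq {poly A}).

(** A morphism that kills the leading coefficient cannot tell [p] from [trunc p]; closure under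
    [trunc] accounts for every drop of degree under specialisation. *)
Definition trunc p : {poly A} := p - lead_coef p *: 'X^((size p).-1).

Lemma size_trunc p : p != 0 -> (size (trunc p) < size p)%N.
Proof.
rewrite -size_poly_gt0 => p0; rewrite -[ltnRHS](prednK p0) ltnS.
apply/leq_sizeP => i; rewrite coefB coefZ coefXn leq_eqVlt => /predU1P[<-|lt].
  by rewrite eqxx mulr1 lead_coefE subrr.
by rewrite gtn_eqF // mulr0 subr0 nth_default // -(prednK p0).
Qed.

(** Closure is demanded only above size [d]: this is vacuous for [d] at least the largest size, and
    [d] is then lowered to 0. *)
Definition sign_closed d Q : Prop :=
  {in Q, forall p, (d < size p)%N -> p^`() \in Q /\ trunc p \in Q} /\
  {in Q &, forall p q, (d < size q <= size p)%N -> Pdiv.Ring.rmodp p q \in Q}.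

(** All three operations lower the size. Once closure holds above size [d + 1], only members of size
    exactly [d + 1] are left to treat, and the polynomials added for them have size at most [d], so
    they raise no demand at this level. *)
Lemma sign_closure Q : exists2 Q', {subset Q <= Q'} & sign_closed 0 Q'.
Proof.
suff H d : forall Q, sign_closed d Q -> exists2 Q', {subset Q <= Q'} & sign_closed 0 Q'.
  have max p : p \in Q -> (size p <= \max_(p <- Q) size p)%N.
    by move=> pQ; apply: (@leq_bigmax_seq _ Q xpredT (fun p : {poly A} => size p)).
  apply: (H (\max_(p <- Q) size p)%N); split=> [p /max|p q _ /max]; rewrite leqNgt.
    by move=> /negPf->.
  by move=> /negPf->.
elim: d => [|d IHd] {}Q [Qu Qb]; first by exists Q.
pose new := map (@deriv A) Q ++ map trunc Q ++ [seq Pdiv.Ring.rmodp p q | p <- Q, q <- Q].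
have [|Q' QQ' cQ'] := IHd (Q ++ [seq p : {poly A} <- new | (size p <= d)%N]); last first.
  by exists Q' => // p pQ; apply: QQ'; rewrite mem_cat pQ.
have old p : p \in Q ++ [seq p : {poly A} <- new | (size p <= d)%N] -> (d < size p)%N -> p \in Q.
  by rewrite mem_cat mem_filter => /orP[//|/andP[le _]]; rewrite ltnNge le.
have newP p : p \in new -> (size p <= d)%N ->
    p \in Q ++ [seq p : {poly A} <- new | (size p <= d)%N].
  by move=> pn le; rewrite mem_cat mem_filter pn le orbT.
split=> [p /old pQ szp|p q /old pQ /old qQ /andP[szq szp]].
  move: (pQ szp) => {}pQ.
  move: szp; rewrite leq_eqVlt => /predU1P[szp|szp]; last first.
    by have [? ?] := Qu p pQ szp; rewrite !mem_cat; split; apply/orP; left.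
  have p0 : p != 0 by rewrite -size_poly_gt0 -szp.
  split; apply: newP.
  - by rewrite mem_cat map_f.
  - by rewrite -ltnS szp lt_size_deriv.
  - by rewrite !mem_cat map_f ?orbT.
  - by rewrite -ltnS szp size_trunc.
move: (pQ (leq_trans szq szp)) (qQ szq) => {}pQ {}qQ.
move: szq; rewrite leq_eqVlt => /predU1P[szq|szq]; last first.
  by rewrite mem_cat Qb ?szq.
have q0 : q != 0 by rewrite -size_poly_gt0 -szq.
apply: newP; last by rewrite -ltnS szq Pdiv.Ring.ltn_rmodpN0.
by rewrite !mem_cat allpairs_f ?orbT.
Qed.

End Closure.

Section Elimination.
Variables (A : comNzRingType) (Q : seq {poly A}).
Hypothesis Qcl : sign_closed 0 Q.
Variables (K1 K2 : rcfType) (phi1 : {rmorphism A -> K1}) (phi2 : {rmorphism A -> K2}).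
Hypothesis lcP : {in Q, forall q, sgz (phi1 (lead_coef q)) = sgz (phi2 (lead_coef q))}.

Let both (q : {poly A}) := (map_poly phi1 q, map_poly phi2 q).

Lemma map_trunc (K : rcfType) (phi : {rmorphism A -> K}) p :
  phi (lead_coef p) = 0 -> map_poly phi (trunc p) = map_poly phi p.
Proof. by move=> lc0; rewrite rmorphB /= map_polyZ /= lc0 scale0r subr0. Qed.

(** Polynomials are added by increasing size, so the derivative, the truncation and the
    pseudo-remainders by smaller members are already present when [p] comes. The second conclusion
    keeps, for every matched point, a member that vanishes there. *)
Lemma elimination_diagram (l l' : seq {poly A}) :
  perm_eq (l ++ l') Q -> sorted (fun p q : {poly A} => size p <= size q)%N (l ++ l') ->
  exists s, diagram s (map both l) /\
    {in s, forall u, exists2 q, q \in l &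
       (map_poly phi1 q != 0) && root (map_poly phi1 q) u.1}.
Proof.
elim/last_ind: l l' => [|l p IHl] l' lQ srt.
  by exists [::]; split.
have [||s [D sl]] := IHl (p :: l'); rewrite -?cat_rcons //.
have memQ q : (q \in Q) = [|| q \in l, q == p | q \in l'].
  by rewrite -(perm_mem lQ) mem_cat mem_rcons inE orbCA orbA.
have tr : transitive (fun p q : {poly A} => size p <= size q)%N.
  by move=> q p' r /=; apply: leq_trans.
move: srt; rewrite cat_rcons (sorted_pairwise tr) pairwise_cat /= allrel_consr.
case/and3P => [/andP[/allP lp /allrelP ll'] _ /andP[/allP pl' _]].
have lower q r : q \in l -> r \in Q -> (size r < size q)%N -> r \in l.
  rewrite memQ => ql /or3P[//|/eqP->|rl'] lt.
    by have := lp q ql; rewrite leqNgt lt.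
  by have := ll' q r ql rl'; rewrite leqNgt lt.
have lowerp r : r \in Q -> (size r < size p)%N -> r \in l.
  rewrite memQ => /or3P[//|/eqP->|rl'] lt; first by rewrite ltnn in lt.
  by have := pl' r rl'; rewrite leqNgt lt.
have lQ' : {subset l <= Q} by move=> q ql; rewrite memQ ql.
have pQ : p \in Q by rewrite memQ eqxx orbT.
have weaken s' : diagram s' (both p :: map both l) -> diagram s' (map both (rcons l p)).
  by apply: diagram_sub => q; rewrite map_rcons mem_rcons.
(* The cases without new matched points: [p] is zero, its leading coefficient is killed, or it is
   constant. *)
have keep : diagram s (both p :: map both l) ->
    exists s, diagram s (map both (rcons l p)) /\
    {in s, forall u, exists2 q, q \in rcons l p &
       (map_poly phi1 q != 0) && root (map_poly phi1 q) u.1}.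
  move=> Dp; exists s; split; first exact: weaken.
  by move=> u /sl[q ql qu]; exists q; rewrite // mem_rcons inE ql orbT.
have [p0|p0] := eqVneq p 0.
  apply: keep; rewrite p0 (_ : both 0 = (0%:P, 0%:P)); last by rewrite /both !rmorph0.
  by apply: diagram_const D; rewrite !sgz0.
have szp0 : (0 < size p)%N by rewrite size_poly_gt0.
have [p'Q tpQ] := Qcl.1 p pQ szp0.
have [lc0|lc0] := eqVneq (phi1 (lead_coef p)) 0.
  have lc0' : phi2 (lead_coef p) = 0.
    by apply/eqP; rewrite -(same_sgz_eq0 (lcP pQ)) lc0.
  apply: keep; apply: diagram_sub D => q; rewrite inE => /predU1P[->|//].
  by rewrite /both -(map_trunc lc0) -(map_trunc lc0') (map_f both) // lowerp // size_trunc.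
have lc0' : phi2 (lead_coef p) != 0 by rewrite -(same_sgz_eq0 (lcP pQ)).
have f0 : map_poly phi1 p != 0 by rewrite -size_poly_gt0 size_map_poly_id0.
have [sz1|szp] := leqP (size p) 1.
  apply: keep; rewrite (size1_polyC sz1) /both !map_polyC /=.
  apply: diagram_const D; have := lcP pQ.
  by rewrite (size1_polyC sz1) lead_coefC coefC eqxx.
have signs : {in s, forall u, sgz (map_poly phi1 p).[u.1] = sgz (map_poly phi2 p).[u.2]}.
  move=> u us; have [q0 q0l /andP[nq0 rq0]] := sl u us.
  have [q ql [lcq rq]] : exists2 q, q \in l & phi1 (lead_coef q) != 0 /\ root (map_poly phi1 q) u.1.
    (* Truncation leaves the image unchanged as long as the leading coefficient is killed, so it
       ends at a member with the same image whose leading coefficient survives. *)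
    have [n] := ubnP (size q0); elim: n => // n IHn in q0 q0l nq0 rq0 *.
    rewrite ltnS => szq0; have [lcq0|] := eqVneq (phi1 (lead_coef q0)) 0; last by exists q0.
    have q00 : q0 != 0 by apply: contraNneq nq0 => ->; rewrite rmorph0.
    have lt := size_trunc q00.
    apply: (IHn (trunc q0)); rewrite ?map_trunc //; last exact: leq_trans lt szq0.
    apply: (lower q0 _ q0l _ lt); have [] := Qcl.1 q0 (lQ' _ q0l) => //.
    by rewrite size_poly_gt0.
  have szq : (size q <= size p)%N by apply: lp.
  have szq0 : (0 < size q)%N.
    by rewrite size_poly_gt0; apply: contraNneq lcq => ->; rewrite lead_coef0 rmorph0.
  have rl : Pdiv.Ring.rmodp p q \in l.
    apply: lowerp; first by apply: (Qcl.2 p q pQ (lQ' _ ql)); rewrite szq0.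
    by apply: leq_trans szq; rewrite Pdiv.Ring.ltn_rmodpN0 // -size_poly_gt0.
  have sg q' : q' \in l -> sgz (map_poly phi1 q').[u.1] = sgz (map_poly phi2 q').[u.2].
    by move=> q'l; apply: (diagram_sign D (diagram_order D us) (map_f both q'l)).
  have rq2 : root (map_poly phi2 q) u.2 by rewrite /root -(same_sgz_eq0 (sg q ql)).
  (* At a root of [q], pseudo-division gives [p] times a power of the leading coefficient of [q] as
     the remainder. The sign of that coefficient is nonzero and common to both sides, so it
     cancels. *)
  have red (K : rcfType) (phi : {rmorphism A -> K}) z : root (map_poly phi q) z ->
      sgz (map_poly phi p).[z] * sgz (phi (lead_coef q)) ^+ Pdiv.Ring.rscalp p q
      = sgz (map_poly phi (Pdiv.Ring.rmodp p q)).[z].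
    move=> /eqP qz; have := Pdiv.ComRing.rdivp_eq q p.
    move/(congr1 (fun h => (map_poly phi h).[z])).
    rewrite /= map_polyZ rmorphD rmorphM /= !hornerE qz mulr0 add0r => <-.
    by rewrite mulrC sgzM rmorphXn sgzX.
  have := sg _ rl; rewrite -!red // (lcP (lQ' _ ql)) => /mulIf; apply.
  by rewrite expf_neq0 // -(lcP (lQ' _ ql)) sgz_eq0.
have [|||||s' [D' s'P]] := diagram_step D (f := map_poly phi1 p) (g := map_poly phi2 p).
- rewrite !deriv_map /=; apply: (map_f both); apply: lowerp => //.
  by rewrite lt_size_deriv.
- by rewrite size_map_poly_id0.
- by rewrite !size_map_poly_id0.
- by rewrite !lead_coef_map_id0 ?rmorph0 ?lcP.
- exact: signs.
exists s'; split; first exact: weaken.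
move=> u /s'P[/sl[q ql qu]|fu]; first by exists q; rewrite // mem_rcons inE ql orbT.
by exists p; rewrite ?mem_rcons ?mem_head // f0.
Qed.

End Elimination.

(** [B], the leading coefficients of the closed family, is chosen before the fields, the morphisms
    and [x]; this makes the elimination iterable. *)
Lemma sign_elimination (A : comNzRingType) (Q : seq {poly A}) :
  exists B : seq A, forall (K1 K2 : rcfType) (phi1 : {rmorphism A -> K1})
    (phi2 : {rmorphism A -> K2}),
    {in B, forall b, sgz (phi1 b) = sgz (phi2 b)} ->
    forall x, exists y,
      {in Q, forall q, sgz (map_poly phi1 q).[x] = sgz (map_poly phi2 q).[y]}.
Proof.
have [Q' QQ' cQ'] := sign_closure Q.
exists (map lead_coef Q') => K1 K2 phi1 phi2 lcP x.
pose le (p q : {poly A}) := (size p <= size q)%N.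
have [|||s [D _]] := @elimination_diagram A Q' cQ' K1 K2 phi1 phi2 _ (sort le Q') [::].
- by move=> q qQ; apply: lcP; apply: map_f.
- by rewrite cats0 perm_sort.
- by rewrite cats0; apply: sort_sorted => p q; apply: leq_total.
have [y xy] := same_cell_exists x (diagram_order D).
exists y => q qQ; apply: (@diagram_sign _ _ _ _ D x y xy (_, _)).
by apply/mapP; exists q => //; rewrite mem_sort QQ'.
Qed.

(** Iterated univariate rings present the outermost variable directly to [sign_elimination], and
    they keep the countability that the algebraic closure asks for. *)
Fixpoint tower (A : CountRing.ComNzRing.type) n : CountRing.ComNzRing.type :=
  if n is n'.+1 then {poly (tower A n')} else A.

Fixpoint tower_eval (A : CountRing.ComNzRing.type) (K : comNzRingType)
    (phi : {rmorphism A -> K}) (x : nat -> K) n : {rmorphism tower A n -> K} :=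
  if n is n'.+1 then horner_eval (x n') \o map_poly (tower_eval phi x n') else phi.

(** * Iterated polynomial rings *)

Fixpoint tower_const (A : CountRing.ComNzRing.type) n : {rmorphism A -> tower A n} :=
  if n is n'.+1 then polyC \o tower_const A n' else idfun.

Fixpoint tower_var (A : CountRing.ComNzRing.type) n (i : nat) : tower A n :=
  if n is n'.+1 then (if i == n' then 'X else (tower_var A n' i)%:P) else 0.

Section Tower.
Variable A : CountRing.ComNzRing.type.

Lemma tower_evalS (K : comNzRingType) (phi : {rmorphism A -> K}) x n (p : tower A n.+1) :
  tower_eval phi x n.+1 p = (map_poly (tower_eval phi x n) p).[x n].
Proof. by []. Qed.

Lemma eq_tower_eval (K : comNzRingType) (phi : {rmorphism A -> K}) x y n :
  (forall i, (i < n)%N -> x i = y i) -> tower_eval phi x n =1 tower_eval phi y n.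
Proof.
elim: n => [//|n IHn] xy p; rewrite !tower_evalS xy // (eq_map_poly (IHn _)) //.
by move=> i lt; rewrite xy // ltnW.
Qed.

Lemma tower_eval_const (K : comNzRingType) (phi : {rmorphism A -> K}) x n a :
  tower_eval phi x n (tower_const A n a) = phi a.
Proof. by elim: n => // n IHn; rewrite tower_evalS /= map_polyC /= hornerC. Qed.

Lemma tower_eval_var (K : comNzRingType) (phi : {rmorphism A -> K}) x n i :
  (i < n)%N -> tower_eval phi x n (tower_var A n i) = x i.
Proof.
elim: n => // n IHn; rewrite ltnS leq_eqVlt tower_evalS /=.
have [->|_ /IHn IHi] := eqVneq i n; first by rewrite map_polyX hornerX.
by rewrite map_polyC /= hornerC.
Qed.

Lemma tower_eval_comp (K L : comNzRingType) (phi : {rmorphism A -> K})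
    (psi : {rmorphism A -> L}) (f : {rmorphism K -> L}) x n :
  f \o phi =1 psi -> f \o tower_eval phi x n =1 tower_eval psi (f \o x) n.
Proof.
move=> fphi; elim: n => [//|n IHn] p.
rewrite [LHS]/= -/tower_eval /horner_eval -horner_map tower_evalS -map_poly_comp.
by congr _.[_]; apply: eq_map_poly.
Qed.

(** The universal property of polynomials: it turns a morphism into an ordered field into the
    coordinates of a point. *)
Lemma rmorph_tower (K : comNzRingType) n (f : {rmorphism tower A n -> K})
    (phi : {rmorphism A -> K}) : f \o tower_const A n =1 phi ->
  exists x, f =1 tower_eval phi x n.
Proof.
elim: n f => [|n IHn] f fphi; first by exists (fun=> 0).
have [|x fx] := IHn (f \o polyC : {rmorphism tower A n -> K}).
  by move=> a; rewrite -fphi.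
exists (fun i => if i == n then f 'X else x i) => p.
rewrite tower_evalS eqxx -[p in LHS]coefK poly_def rmorph_sum horner_poly.
apply: eq_bigr => i _; rewrite -mul_polyC rmorphM rmorphXn /=; congr (_ * _).
have /= -> := fx p`_i; apply: eq_tower_eval => j.
by case: eqVneq => // ->; rewrite ltnn.
Qed.

Lemma tower_sign_transfer n (Q : seq (tower A n)) :
  exists B : seq A, forall (K1 K2 : rcfType) (phi1 : {rmorphism A -> K1})
    (phi2 : {rmorphism A -> K2}),
    {in B, forall b, sgz (phi1 b) = sgz (phi2 b)} ->
    forall x, exists y,
      {in Q, forall q, sgz (tower_eval phi1 x n q) = sgz (tower_eval phi2 y n q)}.
Proof.
elim: n Q => [|n IHn] Q.
  by exists Q => K1 K2 phi1 phi2 phiQ x; exists (fun=> 0).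
have [B BP] := sign_elimination Q.
have [C CP] := IHn B; exists C => K1 K2 phi1 phi2 phiC x.
have [y yP] := CP K1 K2 phi1 phi2 phiC x.
have [z zP] := BP _ _ _ _ yP (x n).
exists (fun i => if i == n then z else y i) => q qQ.
rewrite !tower_evalS eqxx zP //; congr (sgz _.[_]); apply: eq_map_poly.
apply: eq_tower_eval => j.
by case: eqVneq => // ->; rewrite ltnn.
Qed.

End Tower.

(** * Prime cones *)

Section Zorn.
Variable T : Type.
Local Open Scope classical_set_scope.
Implicit Types (X Y : set T) (F : set (set T)).

Lemma total_on_bigcup_pair F x y : total_on F subset ->
  (\bigcup_(X in F) X) x -> (\bigcup_(X in F) X) y -> exists X, [/\ F X, X x & X y].
Proof.
move=> Ftot [X FX Xx] [Y FY Yy].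
by have [XY|YX] := Ftot X Y FX FY; [exists Y|exists X]; split=> //; [apply: XY|apply: YX].
Qed.

Lemma Zorn_above (good : set T -> Prop) (X0 : set T) :
  good X0 ->
  (forall F, F !=set0 -> total_on F subset -> (forall X, F X -> X0 `<=` X /\ good X) ->
     good (\bigcup_(X in F) X)) ->
  exists M, [/\ X0 `<=` M, good M & forall X, M `<=` X -> good X -> X `<=` M].
Proof.
move=> good0 goodU.
(* Zorn's lemma also asks for the union of the empty chain. Testing [X0] joined with [X] instead of
   [X] makes that case [good X0]. *)
have [F FP Ftot|X [gX maxX]] := @Zorn_bigcup T [set X | good (X0 `|` X)].
  have [F0|/set0P[X FX]] := eqVneq F set0.
    by rewrite /= F0 bigcup_set0 setU0.
  have -> : [set X | good (X0 `|` X)] (\bigcup_(X in F) X) =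
      good (\bigcup_(Y in [set X0 `|` X | X in F]) Y).
    rewrite /=; congr good; rewrite bigcup_image eqEsubset; split=> x.
      by case=> [X0x|[Y FY Yx]]; [exists X; last by left|exists Y; last by right].
    by case=> Y FY [|Yx]; [left|right; exists Y].
  apply: goodU => [|_ _ [Y FY <-] [Z FZ <-]|_ [Y FY <-]].
  - by exists (X0 `|` X), X.
  - by have [YZ|ZY] := Ftot Y Z FY FZ; [left|right]; apply: setUS.
  - by split; [apply: subsetUl|apply: FP].
exists (X0 `|` X); split=> // Y XY gY.
have X0Y : X0 `<=` Y by move=> x X0x; apply: XY; left.
have XY' : X `<=` Y by move=> x Xx; apply: XY; right.
have [YX|nYX] := pselect (Y `<=` X); first by move=> y /YX; right.
by case: (maxX Y (conj XY' nYX)); rewrite /= (setUidPr _ _).2.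
Qed.

End Zorn.

Section PrimeCone.
Variables (A : comNzRingType) (g : A) (T : A -> Prop).

(** The last field excludes [-1] for [r = 0]; for [r > 0] it excludes the certificates that [g]
    vanishes wherever [P] is nonnegative. *)
Record preorder_avoiding (P : A -> Prop) : Prop := PreorderAvoiding {
  preorderD : forall x y, P x -> P y -> P (x + y);
  preorderM : forall x y, P x -> P y -> P (x * y);
  preorder_sq : forall x, P (x * x);
  preorder_avoid : forall r, ~ P (- g ^+ (2 * r)) }.

Hypothesis TP : preorder_avoiding T.

Definition support (P : A -> Prop) (x : A) : Prop := P x /\ P (- x).

(** A maximal preorder that avoids every [- g ^+ (2 * r)]. Totality and primality come from one
    argument: adjoining either of two outside elements produces a forbidden power, and the product
    of the two relations is a forbidden power in [P]. *)
Lemma prime_cone : exists P : A -> Prop,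
  [/\ forall x, T x -> P x,
     (forall x y, P x -> P y -> P (x + y)) /\ (forall x y, P x -> P y -> P (x * y)),
     forall x, P x \/ P (- x), ~ P (- 1) /\ ~ support P g &
     forall x y, support P (x * y) -> support P x \/ support P y].
Proof.
have [F [X FX] Ftot FP|P [TP' [PD PM Psq Pav] maxP]] := @Zorn_above A preorder_avoiding T TP.
  split=> [x y Fx Fy|x y Fx Fy|x|r [Y FY Yg]].
  - have [Y [FY Yx Yy]] := total_on_bigcup_pair Ftot Fx Fy.
    by exists Y => //; apply: preorderD (FP Y FY).2 _ _ Yx Yy.
  - have [Y [FY Yx Yy]] := total_on_bigcup_pair Ftot Fx Fy.
    by exists Y => //; apply: preorderM (FP Y FY).2 _ _ Yx Yy.
  - by exists X => //; apply: preorder_sq (FP X FX).2 x.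
  - exact: preorder_avoid (FP Y FY).2 r Yg.
have P0 : P 0 by have := Psq 0; rewrite mulr0.
have P1 : P 1 by have := Psq 1; rewrite mulr1.
have Pg r : P (g ^+ (2 * r)) by rewrite mulnC exprM expr2.
(* The elements [s + t * x] form a preorder that contains [P] and [x]; by maximality it meets the
   forbidden powers. *)
have extend x : ~ P x -> exists r s t, [/\ P s, P t & - g ^+ (2 * r) = s + t * x].
  move=> nPx; apply: contrapT => no.
  apply: nPx; apply: (maxP (fun z => exists s t, [/\ P s, P t & z = s + t * x])).
  - by move=> z Pz; exists z, 0; split; rewrite ?mul0r ?addr0.
  - split.
    + move=> _ _ [s [t [Ps Pt ->]]] [s' [t' [Ps' Pt' ->]]].
      exists (s + s'), (t + t'); split; [exact: PD|exact: PD|ring].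
    + move=> _ _ [s [t [Ps Pt ->]]] [s' [t' [Ps' Pt' ->]]].
      exists (s * s' + t * t' * (x * x)), (s * t' + s' * t).
      split; last by ring.
        exact: PD (PM _ _ Ps Ps') (PM _ _ (PM _ _ Pt Pt') (Psq x)).
      exact: PD (PM _ _ Ps Pt') (PM _ _ Ps' Pt).
    + by move=> z; exists (z * z), 0; split=> //; rewrite mul0r addr0.
    + by move=> r [s [t [Ps Pt E]]]; apply: no; exists r, s, t.
  - by exists 0, 1; split=> //; rewrite mul1r add0r.
have tot x : P x \/ P (- x).
  apply: contrapT => /not_orP[/extend[r [s [t [Ps Pt E]]]] /extend[r' [s' [t' [Ps' Pt' E']]]]].
  apply: (Pav (r + r')%N); rewrite mulnDr exprD.
  (* Expansion of [(g ^+ (2 * r) + s) * (g ^+ (2 * r') + s') = - (t * t' * (x * x))], solved for the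
     product of the powers. *)
  have -> : - (g ^+ (2 * r) * g ^+ (2 * r')) =
      t * t' * (x * x) + s * g ^+ (2 * r') + s' * g ^+ (2 * r) + s * s'.
    have -> : g ^+ (2 * r) = - (s + t * x) by rewrite -E opprK.
    have -> : g ^+ (2 * r') = - (s' + t' * - x) by rewrite -E' opprK.
    ring.
  exact: PD (PD _ _ (PD _ _ (PM _ _ (PM _ _ Pt Pt') (Psq x)) (PM _ _ Ps (Pg r')))
                   (PM _ _ Ps' (Pg r))) (PM _ _ Ps Ps').
have suppMl x y : support P x -> support P (y * x).
  case=> Px PNx; have [Py|PNy] := tot y; split.
  - exact: PM.
  - by rewrite -mulrN; apply: PM.
  - by rewrite -mulrNN; apply: PM.
  - by rewrite -mulNr; apply: PM.
exists P; split=> //.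
  split; first by have := Pav 0; rewrite muln0 expr0.
  move=> /(suppMl _ g)[_]; have := Pav 1; by rewrite muln1 expr2.
move=> x y Pxy; apply: contrapT => /not_orP[nx ny].
(* Off the support, [z] or [- z] is outside [P]; [extend] applies to that one, and the change of
   sign does not affect membership in the support. *)
have ns z : ~ support P z -> exists z' : A, ~ P z' /\ (z = z' \/ z = - z').
  move=> nz; have [Pz|nPz] := pselect (P z); last by exists z; split; [|left].
  by exists (- z); split; [move=> PNz; apply: nz|right; rewrite opprK].
have [x' [/extend[r [s [t [Ps Pt E]]]] x'P]] := ns x nx.
have [y' [/extend[r' [s' [t' [Ps' Pt' E']]]] y'P]] := ns y ny.
have [_ Pxy'] : support P (x' * y').
  case: Pxy => Pxy PNxy.
  by case: x'P PNxy Pxy => ->; case: y'P => ->; rewrite ?(mulNr, mulrN, opprK).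
apply: (Pav (r + r')%N); rewrite mulnDr exprD.
have -> : - (g ^+ (2 * r) * g ^+ (2 * r')) =
    t * t' * (- (x' * y')) + s * g ^+ (2 * r') + s' * g ^+ (2 * r) + s * s'.
  have -> : g ^+ (2 * r) = - (s + t * x') by rewrite -E opprK.
  have -> : g ^+ (2 * r') = - (s' + t' * y') by rewrite -E' opprK.
  ring.
exact: PD (PD _ _ (PD _ _ (PM _ _ (PM _ _ Pt Pt') Pxy') (PM _ _ Ps (Pg r')))
                 (PM _ _ Ps' (Pg r))) (PM _ _ Ps Ps').
Qed.

End PrimeCone.

(** * The residue field of a prime ideal and its algebraic closure *)

Section PrimeQuotient.
Local Open Scope quotient_scope.

Lemma prime_quotient_closure (A : countComNzRingType) (I : A -> Prop) :
  ~ I 1 -> (forall x y, I x -> I y -> I (x + y)) -> (forall x y, I y -> I (x * y)) ->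
  (forall x y, I (x * y) -> I x \/ I y) -> I 0 ->
  exists (L : closedFieldType) (f : {rmorphism A -> L}), forall x, f x = 0 <-> I x.
Proof.
move=> I1 ID IM Iprime I0.
pose S : A -> bool := fun x => `[< I x >].
have Sideal : idealr_closed S.
  split=> [||a x y /asboolP Ix /asboolP Iy]; [exact/asboolP|exact/asboolP|].
  by apply/asboolP; apply: ID Iy; apply: IM.
have Sprime : prime_idealr_closed S.
  by move=> x y /asboolP/Iprime[Ix|Iy]; apply/orP; [left|right]; apply/asboolP.
pose SI := isIdealr.Build A S Sideal.
pose SP := isPrimeIdealrClosed.Build A S Sprime.
pose J : prime_idealr A := HB.pack S SI SP.
pose Q : comNzRingType := {ideal_quot J}.
(* Inverses in the quotient are chosen classically. Off the units the default of [xget] gives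
   [inv x = x], as the ring structure demands. *)
pose unit := [pred x : Q | `[< exists y, y * x = 1 >]].
pose inv (x : Q) : Q := xget x [set y | y * x = 1].
have mulVx : {in unit, left_inverse 1 inv *%R}.
  move=> x /asboolP[y yx]; rewrite /inv; exact: (@xgetI _ x [set y | y * x = 1] y).
have unitP (x y : Q) : y * x = 1 -> x \in unit.
  by move=> yx; apply/asboolP; exists y.
have inv_out : {in [predC unit], inv =1 id}.
  move=> x /= nx; rewrite /inv xgetPN // => y /= yx.
  by case/negP: nx; apply: unitP yx.
pose QU := GRing.ComNzRing_hasMulInverse.Build Q mulVx unitP inv_out.
pose QcU : comUnitRingType := HB.pack Q QU.
pose QD := GRing.ComUnitRing_isIntegral.Build QcU (@Quotient.rquot_IdomainAxiom _ J).
pose D : idomainType := HB.pack QcU QD.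
pose pi : {rmorphism A -> D} := \pi_Q.
have kerpi x : pi x = 0 <-> I x.
  have -> : (pi x = 0) = (x = 0 %[mod Q]) by rewrite -[0 in LHS](rmorph0 pi).
  split=> [/eqP|Ix]; first by rewrite -Quotient.idealrBE subr0 => /asboolP.
  by apply/eqP; rewrite -Quotient.idealrBE subr0; apply/asboolP.
pose F : fieldType := {fraction D}.
(* A fraction is encoded by representatives in [A] of its numerator and denominator, so the
   countability of [A] passes to the fraction field. *)
pose enc (x : F) : A * A := (repr (\n_(repr x) : Q), repr (\d_(repr x) : Q)).
pose dec (z : A * A) : F := \pi_{fraction D} (Ratio (\pi_Q z.1 : D) (\pi_Q z.2 : D)).
have encK : cancel enc dec.
  by move=> x; rewrite /dec /enc /= !reprK FracField.Ratio_numden reprK.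
pose FC := CanIsCountable encK.
pose Fc : countFieldType := HB.pack F FC.
have [L [FtoL _]] := countable_algebraic_closure Fc.
exists L, (FtoL \o (@tofrac D : {rmorphism D -> Fc}) \o pi) => x /=.
rewrite -kerpi; split=> [/eqP|->]; last by rewrite !rmorph0.
by rewrite fmorph_eq0 tofrac_eq0 => /eqP.
Qed.

End PrimeQuotient.

(** * Real closure of an ordered field *)

Definition weighted_sos (R : comNzRingType) (l : seq (R * {poly R})) : {poly R} :=
  \sum_(t <- l) t.1 *: t.2 ^+ 2.

Lemma weighted_sos_cat (R : comNzRingType) (l l' : seq (R * {poly R})) :
  weighted_sos (l ++ l') = weighted_sos l + weighted_sos l'.
Proof. exact: big_cat. Qed.

Lemma weighted_sosM (R : comNzRingType) (l l' : seq (R * {poly R})) :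
  weighted_sos l * weighted_sos l' =
  weighted_sos [seq (t.1 * s.1, t.2 * s.2) | t <- l, s <- l'].
Proof.
rewrite /weighted_sos big_allpairs_dep /= mulr_suml; apply: eq_bigr => t _.
rewrite mulr_sumr; apply: eq_bigr => s _ /=.
by rewrite -scalerAl -scalerAr scalerA exprMn.
Qed.

Lemma weighted_sos_mulsq (R : comNzRingType) (l : seq (R * {poly R})) q :
  weighted_sos [seq (t.1, t.2 * q) | t <- l] = weighted_sos l * q ^+ 2.
Proof.
rewrite /weighted_sos big_map mulr_suml; apply: eq_bigr => t _ /=.
by rewrite exprMn scalerAl.
Qed.

Section SignChange.
Variable E : realFieldType.
Implicit Types (p q : {poly E}) (l : seq (E * {poly E})).

Lemma weighted_sos_ge0 l x : all (fun t => 0 <= t.1) l -> 0 <= (weighted_sos l).[x].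
Proof.
elim: l => [_|t l IHl /= /andP[t0 /IHl l0]]; first by rewrite /weighted_sos big_nil horner0.
rewrite /weighted_sos big_cons hornerD hornerZ horner_exp addr_ge0 //.
by rewrite mulr_ge0 ?sqr_ge0.
Qed.

Lemma sign_change_size p a b : p.[a] * p.[b] < 0 -> (1 < size p)%N.
Proof.
move=> pab; rewrite ltnNge; apply/negP => /size1_polyC pC.
by move: pab; rewrite pC !hornerC -expr2 ltNge sqr_ge0.
Qed.

(* Reducing the weighted squares modulo p makes the cofactor h smaller than p; since the sum
   is positive at a and b, h changes sign as well and divides it: infinite descent. *)
Lemma sign_change_not_dvd l p a b : all (fun t => 0 <= t.1) l ->
  p.[a] * p.[b] < 0 -> ~ p %| 1 + weighted_sos l.
Proof.
have [n] := ubnP (size p); elim: n => // n IHn in p l * => szp l0 pab pl.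
have szp1 := sign_change_size pab.
pose l' := [seq (t.1, t.2 %% p) | t <- l]; pose N := 1 + weighted_sos l'.
have l'0 : all (fun t => 0 <= t.1) l' by rewrite all_map.
have pN : p %| N.
  have -> : N = (1 + weighted_sos l) - (weighted_sos l - weighted_sos l') by rewrite /N; ring.
  apply: dvdp_sub => //; rewrite /weighted_sos big_map -sumrB.
  apply: (big_ind (fun N => p %| N)) => [|q r|t _]; [exact: dvdp0|exact: dvdp_add|].
  rewrite -scalerBr -mul_polyC subr_sqr; apply: dvdp_mull; apply: dvdp_mulr.
  by rewrite {1}(divp_eq t.2 p) addrK dvdp_mulIr.
have p0 : p != 0 by rewrite -size_poly_gt0 ltnW.
have Npos x : 0 < N.[x] by rewrite hornerD hornerC ltr_wpDr ?weighted_sos_ge0.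
have Nhp := divpK pN; set h := N %/ p in Nhp.
(* Remainders have size at most [(size p).-1], so their squares have size at most twice that minus
   1; this makes the cofactor [h] shorter than [p]. *)
have szN : (size N <= (size p).-1 + (size p).-1 - 1)%N.
  have big : (1 <= (size p).-1 + (size p).-1 - 1)%N by lia.
  apply: leq_trans (size_polyD _ _) _; rewrite geq_max size_poly1 big /=.
  rewrite /weighted_sos big_map.
  apply: (big_ind (fun q => size q <= _)%N) => [|q r szq szr|t _].
  - by rewrite size_poly0.
  - by apply: leq_trans (size_polyD _ _) _; rewrite geq_max szq.
  - apply: leq_trans (size_scale_leq _ _) _; rewrite expr2 /=.
    apply: leq_trans (size_polyMleq _ _) _; rewrite -subn1 leq_sub2r //.
    by rewrite leq_add // -ltnS (ltn_predK szp1) ltn_modp.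
have h0 : h != 0.
  by apply: contraTneq (Npos 0) => h0; rewrite -Nhp h0 mul0r horner0 ltxx.
apply: (IHn h l') => //; last by rewrite -[1 + _]/N -Nhp dvdp_mulIl.
- by move: szN szp szp1; rewrite -Nhp size_mul //; move: (size h) (size p) => i j; lia.
- have ha := Npos a; have hb := Npos b; move: ha hb; rewrite -Nhp !hornerM => ha hb.
  have := mulr_gt0 ha hb; rewrite mulrACA => H.
  by rewrite -(nmulr_lgt0 _ pab).
Qed.

(** If [p = r * q], the products of end values multiply to a negative number, so one of the two
    factors changes sign; descent on the size. *)
Lemma sign_change_irreducible p a b : p.[a] * p.[b] < 0 ->
  exists q, [/\ irreducible_poly q, q %| p & q.[a] * q.[b] < 0].
Proof.
have [n] := ubnP (size p); elim: n => // n IHn in p * => szp pab.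
have szp1 := sign_change_size pab.
have p0 : p != 0 by rewrite -size_poly_gt0 ltnW.
have [irr|nirr] := pselect (irreducible_poly p); first by exists p.
have [q [szq qp nqp]] : exists q, [/\ size q != 1%N, q %| p & ~ q %= p].
  apply: contrapT => no; apply: nirr; split=> // q szq qp; apply: contrapT => nqp.
  by apply: no; exists q.
have q0 : q != 0 by apply: contraTneq qp => ->; rewrite dvd0p.
have prq := divpK qp; set r := p %/ q in prq.
have r_p : r %| p by rewrite -[p]prq dvdp_mulIl.
have r0 : r != 0 by apply: contraNneq p0 => r0; rewrite -prq r0 mul0r.
have szqp : (size q < size p)%N.
  by rewrite ltn_neqAle dvdp_leq // andbT; apply/negP; rewrite dvdp_size_eqp //; apply/negP.
have szrp : (size r < size p)%N.
  have j0 := q0; move: szq j0; rewrite -prq size_mul // -size_poly_gt0.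
  by move: (size r) (size q) => i j; lia.
have : (r.[a] * r.[b]) * (q.[a] * q.[b]) < 0 by rewrite mulrACA -!hornerM prq.
have [rn _|rp] := ltP (r.[a] * r.[b]) 0.
  have [s [irr sr sab]] := IHn r (leq_trans szrp szp) rn.
  by exists s; split=> //; apply: (dvdp_trans sr r_p).
have [qn _|qpos] := ltP (q.[a] * q.[b]) 0; last by rewrite ltNge mulr_ge0.
have [s [irr sr sab]] := IHn q (leq_trans szqp szp) qn.
by exists s; split=> //; apply: (dvdp_trans sr qp).
Qed.

End SignChange.

(** Asking for all squares would exclude algebraically closed fields, where [-1] is a square.
    Squares of differences of cone elements suffice to order the subfield that these differences
    form. *)
Record field_cone (L : fieldType) (P : L -> Prop) : Prop := FieldCone {
  field_coneD : forall x y, P x -> P y -> P (x + y);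
  field_coneM : forall x y, P x -> P y -> P (x * y);
  field_coneV : forall x, P x -> P x^-1;
  field_cone_sq : forall x y, P x -> P y -> P ((x - y) * (x - y));
  field_cone1 : P 1;
  field_coneN1 : ~ P (- 1) }.

Record max_cone (L : fieldType) := MaxCone {
  cone_pred :> L -> Prop;
  max_cone_cone : field_cone cone_pred;
  max_cone_max : forall P : L -> Prop, (forall x, cone_pred x -> P x) ->
    field_cone P -> forall x, P x -> cone_pred x }.

Lemma max_cone_above (L : fieldType) (P : L -> Prop) : field_cone P ->
  exists M : max_cone L, forall x, P x -> M x.
Proof.
move=> fP; have [F [X FX] Ftot FP|M [PM fM maxM]] := @Zorn_above L (@field_cone L) P fP.
  split=> [x y Fx Fy|x y Fx Fy|x [Y FY Yx]|x y Fx Fy||[Y FY Y1]].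
  - have [Y [FY Yx Yy]] := total_on_bigcup_pair Ftot Fx Fy.
    by exists Y => //; apply: (field_coneD (FP Y FY).2 Yx Yy).
  - have [Y [FY Yx Yy]] := total_on_bigcup_pair Ftot Fx Fy.
    by exists Y => //; apply: (field_coneM (FP Y FY).2 Yx Yy).
  - by exists Y => //; apply: (field_coneV (FP Y FY).2 Yx).
  - have [Y [FY Yx Yy]] := total_on_bigcup_pair Ftot Fx Fy.
    by exists Y => //; apply: (field_cone_sq (FP Y FY).2 Yx Yy).
  - by exists X => //; apply: (field_cone1 (FP X FX).2).
  - exact: (field_coneN1 (FP Y FY).2 Y1).
by exists (MaxCone fM maxM).
Qed.

Section MaxConeTheory.
Variables (L : fieldType) (M : max_cone L).
Let fM := max_cone_cone M.

Definition cone_diff (x : L) : Prop := exists a b, [/\ M a, M b & x = a - b].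

Let M1 : M 1 := field_cone1 fM.
Let M0 : M 0.
Proof. by have := field_cone_sq fM M1 M1; rewrite subrr mulr0. Qed.

Lemma cone_diff_sub x y : cone_diff x -> cone_diff y -> cone_diff (x - y).
Proof.
move=> [a [b [Ma Mb ->]]] [c [d [Mc Md ->]]]; exists (a + d), (b + c).
by split; [apply: (field_coneD fM)|apply: (field_coneD fM)|ring].
Qed.

Lemma cone_diffM x y : cone_diff x -> cone_diff y -> cone_diff (x * y).
Proof.
move=> [a [b [Ma Mb ->]]] [c [d [Mc Md ->]]]; exists (a * c + b * d), (a * d + b * c).
by split; [apply: (field_coneD fM); apply: (field_coneM fM)
          |apply: (field_coneD fM); apply: (field_coneM fM)|ring].
Qed.

Lemma cone_diff_cone x : M x -> cone_diff x.
Proof. by move=> Mx; exists x, 0; rewrite subr0. Qed.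

Lemma cone_diffD x y : cone_diff x -> cone_diff y -> cone_diff (x + y).
Proof.
move=> Dx Dy; rewrite -[y]opprK -[- y]sub0r; do 2?apply: cone_diff_sub => //.
exact: cone_diff_cone.
Qed.

(** Otherwise the elements [s + t * x] with [s] and [t] in [M] form a cone containing [x], against
    maximality: [x * x] is in [M] since [x] is a difference, and [-1 = s + t * x] would put
    [- x = (1 + s) / t] in [M]. *)
Lemma cone_diff_total x : cone_diff x -> M x \/ M (- x).
Proof.
move=> Dx; apply: contrapT => /not_orP[nMx nMNx]; apply: nMx.
have Mxx : M (x * x) by have [a [b [Ma Mb ->]]] := Dx; apply: (field_cone_sq fM).
pose P y := exists s t, [/\ M s, M t & y = s + t * x].
have PD y z : P y -> P z -> P (y + z).
  move=> [s [t [Ms Mt ->]]] [s' [t' [Ms' Mt' ->]]]; exists (s + s'), (t + t').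
  by split; [apply: (field_coneD fM)|apply: (field_coneD fM)|ring].
have PM y z : P y -> P z -> P (y * z).
  move=> [s [t [Ms Mt ->]]] [s' [t' [Ms' Mt' ->]]].
  exists (s * s' + t * t' * (x * x)), (s * t' + s' * t).
  split; last by ring.
    apply: (field_coneD fM); first exact: (field_coneM fM).
    by apply: (field_coneM fM) => //; apply: (field_coneM fM).
  by apply: (field_coneD fM); apply: (field_coneM fM).
have MP y : M y -> P y by move=> My; exists y, 0; rewrite mul0r addr0.
have PD' y : P y -> cone_diff y.
  move=> [s [t [Ms Mt ->]]]; apply: cone_diffD; first exact: cone_diff_cone.
  by apply: cone_diffM => //; apply: cone_diff_cone.
have Dsq y : cone_diff y -> M (y * y).
  by move=> [a [b [Ma Mb ->]]]; apply: (field_cone_sq fM).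
apply: (max_cone_max (P := P)); last by exists 0, 1; rewrite add0r mul1r.
  exact: MP.
split=> // [y Py|y z Py Pz||].
- have [->|y0] := eqVneq y 0; first by rewrite invr0; apply: MP.
  have -> : y^-1 = y * (y * y)^-1 by rewrite invfM mulrA divff // mul1r.
  by apply: PM => //; apply/MP/(field_coneV fM)/Dsq/PD'.
- by apply/MP/Dsq/cone_diff_sub; apply: PD'.
- exact: MP.
move=> [s [t [Ms Mt E]]].
have [t0|t0] := eqVneq t 0.
  by apply: (field_coneN1 fM); rewrite E t0 mul0r addr0.
apply: nMNx; have -> : - x = (1 + s) * t^-1.
  by apply: (mulIf t0); rewrite divfK // -[1]opprK E; ring.
by apply: (field_coneM fM); [apply: (field_coneD fM)|apply: (field_coneV fM)].
Qed.

Lemma max_cone_anti x : M x -> M (- x) -> x = 0.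
Proof.
move=> Mx MNx; apply: contrapT => /eqP x0; apply: (field_coneN1 fM).
have -> : -1 = - x * x^-1 by rewrite mulNr divff.
by apply: (field_coneM fM) => //; apply: (field_coneV fM).
Qed.

Definition cone_field : {pred L} := fun x => `[< M x \/ M (- x) >].

Lemma cone_fieldP x : reflect (cone_diff x) (x \in cone_field).
Proof.
apply: (iffP (asboolP _)) => [[Mx|Mx]|]; last exact: cone_diff_total.
  exact: cone_diff_cone.
by exists 0, (- x); rewrite sub0r opprK.
Qed.

Lemma cone_field_divring : divring_closed cone_field.
Proof.
split=> [|x y /cone_fieldP Dx /cone_fieldP Dy|x y /cone_fieldP Dx /asboolP Dy].
- exact/cone_fieldP/cone_diff_cone.
- exact/cone_fieldP/cone_diff_sub.
- apply/cone_fieldP/cone_diffM => //; apply/cone_fieldP/asboolP.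
  by case: Dy => /(field_coneV fM); rewrite ?invrN; [left|right].
Qed.

HB.instance Definition _ := GRing.isDivringClosed.Build L cone_field cone_field_divring.

End MaxConeTheory.

(* Real closed when [L] is algebraically closed; see [rc_real_closed]. *)
Definition real_closure (L : fieldType) (M : max_cone L) : Type :=
  {x : L | x \in cone_field M}.

Section RealClosure.
Variables (L : fieldType) (M : max_cone L).
Local Notation E := (real_closure M).
Let fM := max_cone_cone M.

HB.instance Definition _ := SubChoice.on E.
HB.instance Definition _ := [SubChoice_isSubIntegralDomain of E by <:].
HB.instance Definition _ := [SubIntegralDomain_isSubField of E by <:].

Definition rc_le (x y : E) : bool := `[< M (val y - val x) >].
Definition rc_norm (x : E) : E := if rc_le 0 x then x else - x.

Let rc_ge0 x : rc_le 0 x = `[< M (val x) >].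
Proof. by rewrite /rc_le subr0. Qed.
Let rc_le0 x : rc_le x 0 = `[< M (- val x) >].
Proof. by rewrite /rc_le sub0r. Qed.

Let rc_le0_add x y : rc_le 0 x -> rc_le 0 y -> rc_le 0 (x + y).
Proof.
rewrite !rc_ge0 => /asboolP Mx /asboolP My; apply/asboolP.
exact: (field_coneD fM).
Qed.
Let rc_le0_mul x y : rc_le 0 x -> rc_le 0 y -> rc_le 0 (x * y).
Proof.
rewrite !rc_ge0 => /asboolP Mx /asboolP My; apply/asboolP.
exact: (field_coneM fM).
Qed.
Let rc_le0_anti x : rc_le 0 x -> rc_le x 0 -> x = 0.
Proof.
rewrite rc_ge0 rc_le0 => /asboolP Mx /asboolP MNx; apply: val_inj.
exact: max_cone_anti Mx MNx.
Qed.
Let rc_sub_ge0 x y : rc_le 0 (y - x) = rc_le x y.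
Proof. by rewrite rc_ge0. Qed.
Let rc_le0_total x : rc_le 0 x || rc_le x 0.
Proof.
rewrite rc_ge0 rc_le0; have /asboolP[Mx|Mx] := valP x.
  by apply/orP; left; apply/asboolP.
by apply/orP; right; apply/asboolP.
Qed.
Let rc_normN x : rc_norm (- x) = rc_norm x.
Proof.
rewrite /rc_norm opprK; case: ifP => nx; case: ifP => px //.
  have x0 : x = 0 by apply: rc_le0_anti => //; rewrite -rc_sub_ge0 sub0r.
  by rewrite x0 oppr0.
by have := rc_le0_total x; rewrite px -rc_sub_ge0 sub0r nx.
Qed.
Let rc_ge0_norm x : rc_le 0 x -> rc_norm x = x.
Proof. by rewrite /rc_norm => ->. Qed.

HB.instance Definition _ := Num.IntegralDomain_isLeReal.Build E
  rc_le0_add rc_le0_mul rc_le0_anti rc_sub_ge0 rc_le0_total rc_normN rc_ge0_norm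
  (fun _ _ => erefl).

Lemma rc_ge0P (x : E) : reflect (M (val x)) (0 <= x).
Proof. by have -> : (0 <= x) = rc_le 0 x by []; rewrite rc_ge0; apply: asboolP. Qed.

End RealClosure.

Section RealClosed.
Variables (L : closedFieldType) (M : max_cone L).
Local Notation E := (real_closure M).
Let fM := max_cone_cone M.

Lemma rc_irreducible_root (q : {poly E}) (a b : E) : irreducible_poly q ->
  q.[a] * q.[b] < 0 -> exists x, root q x.
Proof.
move=> irr qab; have szq := sign_change_size qab.
have [toL toLE] : exists f : {rmorphism E -> L}, f =1 val by exists \val.
have [theta qtheta] : exists theta, root (map_poly toL q) theta.
  by apply/closed_rootP; rewrite size_map_poly gtn_eqF.
have evD (u v : {poly E}) : (map_poly toL (u + v)).[theta] =
    (map_poly toL u).[theta] + (map_poly toL v).[theta] by rewrite rmorphD hornerD.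
have evB (u v : {poly E}) : (map_poly toL (u - v)).[theta] =
    (map_poly toL u).[theta] - (map_poly toL v).[theta].
  by rewrite rmorphB hornerD hornerN.
have evM (u v : {poly E}) : (map_poly toL (u * v)).[theta] =
    (map_poly toL u).[theta] * (map_poly toL v).[theta] by rewrite rmorphM hornerM.
(* The values at [theta] form a field: as [q] is irreducible, a Bezout cofactor inverts every value
   not forced to vanish. *)
have bezout (v : {poly E}) : ~ q %| v -> exists u, (map_poly toL (u * v)).[theta] = 1.
  move=> nqv; have /Bezout_eq1_coprimepP[[u1 u2] /= uv] : coprimep v q.
    rewrite coprimep_sym; rewrite irreducible_poly_coprime //.
    exact/negP.
  exists u1; have : (map_poly toL (u1 * v + u2 * q)).[theta] = 1 by rewrite uv rmorph1 hornerC.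
  by rewrite evD (evM u2) (eqP qtheta) mulr0 addr0.
(* The sums of squares of E(theta) with weights in M form a cone, by [sign_change_not_dvd], so
   they lie in M; and theta is a difference of squares up to a factor 4. *)
pose P y := exists2 l : seq (E * {poly E}), all (fun t => 0 <= t.1) l
  & y = (map_poly toL (weighted_sos l)).[theta].
have Psq (v : {poly E}) : P (map_poly toL (v * v)).[theta].
  by exists [:: (1, v)]; rewrite /= ?ler01 // /weighted_sos big_seq1 scale1r expr2.
have MP y : M y -> P y.
  move=> My; have yE : y \in cone_field M by apply/asboolP; left.
  exists [:: (exist _ y yE : E, 1)] => /=; first by rewrite andbT; apply/rc_ge0P.
  by rewrite /weighted_sos big_seq1 /= expr1n alg_polyC map_polyC /= hornerC toLE.
have Pcone : field_cone P.
  split.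
  - move=> _ _ [l l0 ->] [l' l'0 ->]; exists (l ++ l'); first by rewrite all_cat l0.
    by rewrite weighted_sos_cat evD.
  - move=> _ _ [l /allP l0 ->] [l' /allP l'0 ->].
    exists [seq (t.1 * s.1, t.2 * s.2) | t <- l, s <- l']; last by rewrite -weighted_sosM evM.
    by apply/allP => z /allpairsP[[t u] [/= tl ul ->]] /=; apply: mulr_ge0; [apply: l0|apply: l'0].
  - move=> _ [l /allP l0 ->]; set y := _.[theta].
    have [->|y0] := eqVneq y 0.
      by exists [::] => //; rewrite /weighted_sos big_nil invr0 rmorph0 horner0.
    have [|u] := bezout (weighted_sos l).
      move=> /dvdpP[h E1]; case/negP: y0; rewrite /y E1 evM.
      by rewrite (eqP qtheta) mulr0.
    (* With [u] inverse to [y] at [theta], [y^-1] is [y] times the square of the value of [u]: the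
       weights are unchanged and the squared polynomials are multiplied by [u]. *)
    rewrite evM -/y => uy; exists [seq (t.1, t.2 * u) | t <- l].
      by apply/allP => _ /mapP[t tl ->] /=; apply: l0.
    rewrite weighted_sos_mulsq evM -/y expr2 evM mulrA [y * _]mulrC uy mul1r.
    by apply: (mulIf y0); rewrite mulVf.
  - by move=> _ _ [l _ ->] [l' _ ->]; rewrite -evB -evM.
  - exact: MP (field_cone1 fM).
  - move=> [l l0 E1]; apply: (sign_change_not_dvd l0 qab).
    apply: contrapT => /bezout[u]; rewrite evM evD -E1 rmorph1 hornerC subrr mulr0.
    by move/eqP; rewrite eq_sym oner_eq0.
have PM := max_cone_max MP Pcone.
have thetaE : theta \in cone_field M.
  have four : (map_poly toL ('X + 1)).[theta] * (map_poly toL ('X + 1)).[theta]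
     - (map_poly toL ('X - 1)).[theta] * (map_poly toL ('X - 1)).[theta] = theta * toL 4%:R.
    rewrite evD evB map_polyX hornerX rmorph1 hornerC rmorph_nat; ring.
  have n4 : toL 4%:R != 0 by rewrite fmorph_eq0 pnatr_eq0.
  rewrite -[theta](mulfK n4) -four; apply: rpred_div.
    apply/cone_fieldP; rewrite -!evM; exists (map_poly toL (('X + 1) * ('X + 1))).[theta].
    by exists (map_poly toL (('X - 1) * ('X - 1))).[theta]; split=> //; apply/PM/Psq.
  by rewrite toLE; apply: valP.
exists (exist _ theta thetaE : E).
by rewrite -(fmorph_root toL) toLE.
Qed.

(** An irreducible factor that changes sign has a root, hence is linear up to a constant; a linear
    polynomial changes sign only across its root, which places the root between [a] and [b]. *)
Lemma rc_real_closed : Num.real_closed_axiom E.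
Proof.
move=> p a b le_ab /andP[pa pb].
have [pa0|pa0] := eqVneq p.[a] 0; first by exists a; rewrite ?lexx //; apply/eqP.
have [pb0|pb0] := eqVneq p.[b] 0; first by exists b; rewrite ?lexx ?andbT //; apply/eqP.
have pab : p.[a] * p.[b] < 0.
  by rewrite nmulr_rlt0 ?lt_neqAle ?pa0 // eq_sym pb0.
have [q [irr qp qab]] := sign_change_irreducible pab.
have [x qx] := rc_irreducible_root irr qab.
have px : root p x by have /dvdpP[r ->] := qp; rewrite rootM qx orbT.
exists x => //.
have : ('X - x%:P) %= q by apply: irr.2; rewrite ?size_XsubC // dvdp_XsubCl.
case/eqpP => -[c1 c2] /= /andP[c10 c20] E1.
have : (c2 * q.[a]) * (c2 * q.[b]) < 0.
  by rewrite mulrACA pmulr_rlt0 // -expr2 exprn_even_gt0.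
rewrite -!hornerZ -E1 !hornerZ !hornerXsubC mulrACA pmulr_rlt0; last first.
  by rewrite -expr2 exprn_even_gt0.
have [xa|ax] := ltP x a.
  by rewrite ltNge mulr_ge0 // subr_ge0 ltW // (lt_le_trans xa).
have [bx|xb] := ltP b x; last by [].
by rewrite ltNge mulr_le0 // subr_le0 ltW // (le_lt_trans le_ab).
Qed.

HB.instance Definition _ := Num.RealField_isClosed.Build E rc_real_closed.

End RealClosed.

(** * A point over a real closed field *)

Lemma ordered_point (A : countComNzRingType) (g : A) (T : A -> Prop) :
  preorder_avoiding g T ->
  exists (E : rcfType) (h : {rmorphism A -> E}),
    (forall x, T x -> 0 <= h x) /\ h g != 0.
Proof.
move=> /prime_cone[P [TP [PD PM] Ptot [PN1 nPg] Pprime]].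
have Psq x : P (x * x).
  by have [Px|Px] := Ptot x; [|rewrite -mulrNN]; apply: PM.
have P0 : P 0 by have := Psq 0; rewrite mulr0.
have P1 : P 1 by have := Psq 1; rewrite mulr1.
have suppM x y : support P y -> support P (x * y).
  case=> Py PNy; have [Px|PNx] := Ptot x; split.
  - exact: PM.
  - by rewrite -mulrN; apply: PM.
  - by rewrite -mulrNN; apply: PM.
  - by rewrite -mulNr; apply: PM.
have suppD x y : support P x -> support P y -> support P (x + y).
  by case=> Px PNx [Py PNy]; split; rewrite ?opprD; apply: PD.
have [||L [f fP]] := prime_quotient_closure _ suppD suppM Pprime.
- by case.
- by rewrite /support oppr0.
(* [a / b] is [a * b] divided by a square, so this is the nonnegative part of the ordered fraction
   field, seen inside [L]. *)
pose C x := exists a b, [/\ f b != 0, P (a * b) & x = f a / f b].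
have fC x : P x -> C (f x).
  by move=> Px; exists x, 1; rewrite rmorph1 oner_neq0 mulr1 divr1.
have Cratio a b : f b != 0 -> C ((f a / f b) * (f a / f b)).
  move=> fb; exists (a * a), (b * b); rewrite !rmorphM mulf_neq0 //; split=> //.
    by rewrite mulrACA.
  by rewrite -mulf_div.
have Ccone : field_cone C.
  split.
  - move=> _ _ [a [b [fb Pab ->]]] [c [d [fd Pcd ->]]].
    exists (a * d + c * b), (b * d); rewrite rmorphM mulf_neq0 //; split=> //.
      have -> : (a * d + c * b) * (b * d) = a * b * (d * d) + c * d * (b * b) by ring.
      by apply: PD; apply: PM.
    by rewrite addf_div // rmorphD !rmorphM.
  - move=> _ _ [a [b [fb Pab ->]]] [c [d [fd Pcd ->]]].
    exists (a * c), (b * d); rewrite !rmorphM mulf_neq0 //; split=> //.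
      by rewrite mulrACA; apply: PM.
    by rewrite mulf_div.
  - move=> _ [a [b [fb Pab ->]]]; have [fa|fa] := eqVneq (f a) 0.
      by rewrite fa mul0r invr0 -(rmorph0 f); apply: fC.
    by exists b, a; rewrite mulrC invf_div; split=> //; rewrite mulrC.
  - move=> _ _ [a [b [fb Pab ->]]] [c [d [fd Pcd ->]]].
    have -> : f a / f b - f c / f d = f (a * d - c * b) / f (b * d).
      by rewrite -mulNr addf_div // rmorphB !rmorphM mulNr.
    by apply: Cratio; rewrite rmorphM mulf_neq0.
  - by rewrite -(rmorph1 f); apply: fC.
  (* If [-1 = f a / f b], then [a + b] is in the support, hence [- (b * b) = a * b - b * (a + b)] is
     in [P]; primality puts [b] in the support, against [f b != 0]. *)
  - move=> [a [b [fb Pab E1]]].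
    have sab : support P (a + b).
      by apply/fP; rewrite rmorphD -[f a](divfK fb) -E1 mulN1r addNr.
    have [_ PN] := suppM b _ sab.
    have sbb : support P (b * b).
      split=> //; have -> : - (b * b) = a * b + - (b * (a + b)) by ring.
      exact: PD.
    by case/eqP: fb; apply/fP; case: (Pprime _ _ sbb).
have [M CM] := max_cone_above Ccone.
have fM x : f x \in cone_field M.
  apply/asboolP; have [Px|Px] := Ptot x; [left|right]; apply: CM; first exact: fC.
  by rewrite -rmorphN; apply: fC.
pose E : rcfType := real_closure M.
pose h (x : A) : E := exist _ (f x) (fM x).
have hB : zmod_morphism h by move=> x y; apply: val_inj; rewrite /= rmorphB.
have hM : monoid_morphism h.
  by split=> [|x y]; apply: val_inj; rewrite /= ?rmorph1 ?rmorphM.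
pose hBi := GRing.isZmodMorphism.Build A E h hB.
pose hMi := GRing.isMonoidMorphism.Build A E h hM.
pose hR : {rmorphism A -> E} := HB.pack h hBi hMi.
exists E, hR; split=> [x /TP Px|]; first by apply/rc_ge0P/CM/fC.
by apply/eqP => /(congr1 val) /= /fP.
Qed.

(** * The Positivstellensatz *)

Section Stengle.
Variables (R : realType) (N : nat).
Implicit Types (f : {mpoly R[N]}) (cs : seq R).

Definition var_or_0 (i : nat) : {mpoly R[N]} := if insub i is Some j then 'X_j else 0.

Definition int_params cs : {rmorphism tower int (size cs) -> R} :=
  tower_eval (intmul 1 : {rmorphism int -> R}) (nth 0 cs) (size cs).

(** Unlike the polynomials over [R], its domain is countable: the inner tower holds the parameters
    that stand for [cs], the outer one the [N] variables. *)
Definition int_poly cs : {rmorphism tower (tower int (size cs)) N -> {mpoly R[N]}} :=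
  tower_eval (@mpolyC N R \o int_params cs) var_or_0 N.

Lemma int_poly_onto cs f : {in msupp f, forall m, f@_m \in cs} ->
  exists F, int_poly cs F = f.
Proof.
move=> fcs; rewrite [f]mpolyE big_seq.
pose S f := exists F, int_poly cs F = f.
have SD f1 f2 : S f1 -> S f2 -> S (f1 + f2).
  by move=> [F1 <-] [F2 <-]; exists (F1 + F2); rewrite rmorphD.
have SM f1 f2 : S f1 -> S f2 -> S (f1 * f2).
  by move=> [F1 <-] [F2 <-]; exists (F1 * F2); rewrite rmorphM.
have S1 : S 1 by exists 1; rewrite rmorph1.
apply: (big_ind S) => [||m mf]; [by exists 0; rewrite rmorph0|exact: SD|].
rewrite -mul_mpolyC; apply: (SM).
  exists (tower_const _ N (tower_var int (size cs) (index f@_m cs))).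
  rewrite tower_eval_const /= /int_params tower_eval_var ?index_mem ?fcs //.
  by rewrite nth_index ?fcs.
rewrite mpolyXE_id; apply: (big_ind S S1 SM) => i _.
elim: (m i) => [|k IHk]; rewrite ?expr0 // exprS; apply: (SM) => //.
exists (tower_var _ N i); rewrite /int_poly tower_eval_var //.
by rewrite /var_or_0 valK.
Qed.

Lemma meval_int_poly cs F (x : nat -> R) :
  (int_poly cs F).@[fun i : 'I_N => x i] = tower_eval (int_params cs) x N F.
Proof.
pose v (i : 'I_N) := x i.
have mC : (meval v : {rmorphism _ -> _}) \o (@mpolyC N R \o int_params cs) =1 int_params cs.
  by move=> a; rewrite /= mevalC.
rewrite -[LHS]/((meval v \o int_poly cs) F) (tower_eval_comp var_or_0 mC F).
apply: eq_tower_eval => i iN.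
by rewrite /= /var_or_0 insubT mevalXU.
Qed.

(** Keeping [T] abstract allows its preimage under [int_poly] to serve as the preorder. That
    preimage contains every parameter polynomial whose real value is a square, which a preorder
    generated over the integers would miss. *)
Theorem stengle (T : {mpoly R[N]} -> Prop) (fs : seq {mpoly R[N]}) (g : {mpoly R[N]}) :
  (forall f1 f2, T f1 -> T f2 -> T (f1 + f2)) ->
  (forall f1 f2, T f1 -> T f2 -> T (f1 * f2)) ->
  (forall f, T (f * f)) -> {in fs, forall f, T f} ->
  (forall x : 'I_N -> R, {in fs, forall f, 0 <= f.@[x]} -> g.@[x] = 0) ->
  exists r, T (- g ^+ (2 * r)).
Proof.
move=> TD TM Tsq Tfs empty; apply: contrapT => nocert.
pose cs := flatten [seq [seq f@_m | m <- msupp f] | f <- g :: fs].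
have preim f : f \in g :: fs -> exists F, int_poly cs F = f.
  move=> fin; apply: int_poly_onto => m mf; apply/flatten_mapP; exists f => //.
  exact: map_f.
have [G GP] := preim g (mem_head _ _).
have [Fs FsP] : exists Fs, map (int_poly cs) Fs = fs.
  elim: (fs) preim => [|f l IHl] preim; first by exists [::].
  have [F FE] : exists F, int_poly cs F = f by apply: preim; rewrite !inE eqxx orbT.
  have [Fl FlE] : exists Fs, map (int_poly cs) Fs = l.
    apply: IHl => f'; rewrite inE => /orP[f'g|f'l]; apply: preim; rewrite !inE ?f'g //.
    by rewrite f'l !orbT.
  by exists (F :: Fl); rewrite /= FE FlE.
have pre : preorder_avoiding G (fun s => T (int_poly cs s)).
  split=> [x y Tx Ty|x y Tx Ty|x|r TG].
  - by rewrite rmorphD; apply: TD.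
  - by rewrite rmorphM; apply: TM.
  - by rewrite rmorphM; apply: Tsq.
  - by apply: nocert; exists r; rewrite -GP -rmorphXn -rmorphN.
have [E [h [hT hG]]] := ordered_point pre.
pose phi1 : {rmorphism tower int (size cs) -> E} := h \o tower_const _ N.
(* A nonnegative real value is the square of its root, so the corresponding constant lies in [T]. *)
have ge0 a : 0 <= int_params cs a -> 0 <= phi1 a.
  move=> a0; apply: hT; rewrite /int_poly tower_eval_const /=.
  by rewrite -[int_params cs a]sqr_sqrtr // expr2 mpolyCM; apply: Tsq.
(* An element that is positive in R exceeds 1 / n for some n, so that it cannot vanish in E. *)
have gt0 a : 0 < int_params cs a -> 0 < phi1 a.
  move=> a0; set x := (int_params cs a)^-1.
  have := archi_boundP (ltW (_ : 0 < x)); rewrite invr_gt0 => /(_ a0).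
  set n := Num.bound x => xn; have : 0 <= phi1 (a *+ n - 1).
    apply: ge0; rewrite rmorphB rmorphMn rmorph1 subr_ge0 -mulr_natl.
    by rewrite -ler_pdivrMr // mul1r ltW.
  rewrite rmorphB rmorphMn rmorph1 subr_ge0 => H; rewrite ltNge; apply/negP => a1.
  by have := le_trans H (mulrn_wle0 n a1); rewrite ler10.
have sg a : sgz (phi1 a) = sgz (int_params cs a).
  case: (ltgtP (int_params cs a) 0) => [a0|a0|a0].
  - have : 0 < phi1 (- a) by rewrite gt0 // rmorphN oppr_gt0.
    by rewrite rmorphN oppr_gt0 => a1; rewrite !ltr0_sgz.
  - by rewrite !gtr0_sgz // gt0.
  - have := ge0 a; rewrite a0 lexx => /(_ isT) p1.
    have := ge0 (- a); rewrite !rmorphN a0 oppr0 lexx oppr_ge0 => /(_ isT) p2.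
    have /eqP -> : phi1 a == 0 by rewrite eq_le p1 p2.
    by rewrite sgz0 sgz0.
have [x xP] := rmorph_tower (f := h) (phi := phi1) (fun=> erefl).
(* [sg] compares all parameter polynomials, hence in particular those in [B]. *)
have [B BP] := tower_sign_transfer (G :: Fs).
have [y yP] := BP _ _ phi1 (int_params cs) (fun b _ => sg b) x.
have hy F : F \in G :: Fs -> sgz (h F) = sgz (int_poly cs F).@[fun i : 'I_N => y i].
  by move=> FG; rewrite xP yP // meval_int_poly.
case/eqP: hG; apply/eqP; rewrite (same_sgz_eq0 (hy G (mem_head _ _))) GP empty //.
move=> f; rewrite -FsP => /mapP[F FFs ->].
have FG : F \in G :: Fs by rewrite inE FFs orbT.
by rewrite -(same_sgz_ge0 (hy F FG)); apply/hT/Tfs; rewrite -FsP map_f.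
Qed.

End Stengle.

(** * Certificates and feasibility *)

Section CertificateForm.
Variables (R : comNzRingType) (s p : nat) (a : 'I_s -> R) (b : 'I_p -> R).

(** A list may repeat a set, so sums are concatenations; terms with equal sets are collected only at
    the end, by [cone_sum_group]. *)
Definition cone_sum (l : seq (R * {set 'I_s})) : R :=
  \sum_(t <- l) t.1 ^+ 2 * \prod_(i in t.2) a i.
Definition ideal_sum (rho : 'I_p -> R) : R := \sum_i rho i * b i.

Definition cone_plus_ideal (f : R) : Prop := exists l rho, f = cone_sum l + ideal_sum rho.

Lemma ideal_sumD rho rho' : ideal_sum rho + ideal_sum rho' = ideal_sum (rho \+ rho').
Proof. by rewrite -big_split; apply: eq_bigr => i _; rewrite mulrDl. Qed.

Lemma ideal_sumM c rho : c * ideal_sum rho = ideal_sum (fun i => c * rho i).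
Proof. by rewrite mulr_sumr; apply: eq_bigr => i _; rewrite mulrA. Qed.

Lemma ideal_sum0 : ideal_sum (fun=> 0) = 0.
Proof. by apply: big1 => i _; rewrite mul0r. Qed.

(** Two products over sets multiply to the product over the symmetric difference times the square of
    the product over the intersection. The square joins the coefficient, so products over subsets
    are closed under multiplication and no exponents arise. *)
Lemma cone_sumM l l' : exists l'', cone_sum l * cone_sum l' = cone_sum l''.
Proof.
pose mul (t t' : R * {set 'I_s}) :=
  (t.1 * t'.1 * \prod_(i in t.2 :&: t'.2) a i, (t.2 :\: t'.2) :|: (t'.2 :\: t.2)).
exists [seq mul t t' | t <- l, t' <- l'].
rewrite /cone_sum big_allpairs_dep /= mulr_suml; apply: eq_bigr => t _.
rewrite mulr_sumr; apply: eq_bigr => t' _ /=.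
rewrite (bigID (mem t'.2) (mem t.2)) (bigID (mem t.2) (mem t'.2)) /=.
have -> : \prod_(i in t.2 :\: t'.2 :|: t'.2 :\: t.2) a i =
    \prod_(i in t.2 | i \notin t'.2) a i * \prod_(i in t'.2 | i \notin t.2) a i.
  rewrite (eq_bigl [predU t.2 :\: t'.2 & t'.2 :\: t.2]); last first.
    by move=> i; rewrite !inE.
  rewrite bigU /=; last first.
    by rewrite disjoint_subset; apply/fintype.subsetP => i; rewrite !inE; do 2!case: (_ \in _).
  by congr (_ * _); apply: eq_bigl => i; rewrite !inE andbC.
have -> : \prod_(i in t.2 | i \in t'.2) a i = \prod_(i in t.2 :&: t'.2) a i.
  by apply: eq_bigl => i; rewrite !inE.
have -> : \prod_(i in t'.2 | i \in t.2) a i = \prod_(i in t.2 :&: t'.2) a i.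
  by apply: eq_bigl => i; rewrite !inE andbC.
ring.
Qed.

Lemma cone_plus_idealD f g :
  cone_plus_ideal f -> cone_plus_ideal g -> cone_plus_ideal (f + g).
Proof.
move=> [l [rho ->]] [l' [rho' ->]]; exists (l ++ l'), (rho \+ rho').
by rewrite -ideal_sumD /cone_sum big_cat /=; ring.
Qed.

Lemma cone_plus_idealM f g :
  cone_plus_ideal f -> cone_plus_ideal g -> cone_plus_ideal (f * g).
Proof.
move=> [l [rho ->]] [l' [rho' ->]]; have [l'' E] := cone_sumM l l'.
exists l'', ((fun i => cone_sum l * rho' i) \+ (fun i => (cone_sum l' + ideal_sum rho') * rho i)).
by rewrite -ideal_sumD -!ideal_sumM -E; ring.
Qed.

Lemma cone_plus_ideal_sq f : cone_plus_ideal (f * f).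
Proof.
exists [:: (f, finset.set0)], (fun=> 0); rewrite ideal_sum0 /cone_sum big_seq1 big_set0.
by rewrite mulr1 addr0 expr2.
Qed.

Lemma cone_plus_ideal_gen i : cone_plus_ideal (a i).
Proof.
exists [:: (1, [set i]%SET)], (fun=> 0); rewrite ideal_sum0 /cone_sum big_seq1 big_set1.
by rewrite expr1n mul1r addr0.
Qed.

Lemma cone_plus_ideal_ideal i c : cone_plus_ideal (c * b i).
Proof.
exists [::], (fun j => (j == i)%:R * c); rewrite /cone_sum big_nil add0r /ideal_sum.
rewrite (bigD1 i) //= eqxx mul1r big1 ?addr0 // => j /negPf ->.
by rewrite !mul0r.
Qed.

Lemma cone_sum_group l :
  cone_sum l = \sum_(S : {set 'I_s}) (\sum_(t <- l | t.2 == S) t.1 ^+ 2) * \prod_(i in S) a i.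
Proof.
under [RHS]eq_bigr do rewrite mulr_suml big_mkcond /=.
rewrite exchange_big /=; apply: eq_bigr => t _.
rewrite [RHS](bigD1 t.2) //= eqxx [X in _ + X]big1 ?addr0 // => S /negPf.
by rewrite eq_sym => ->.
Qed.

End CertificateForm.

Lemma norm2_le (R : realType) n (v : 'cV[R]_n) (c : R) : 0 < c ->
  (norm2 v <= c) = (\sum_i v i 0 ^+ 2 <= c ^+ 2).
Proof.
move=> c0; have cE : c = Num.sqrt (c ^+ 2) by rewrite sqrtr_sqr ger0_norm // ltW.
by rewrite /norm2 {1}cE ler_sqrt ?sqr_ge0.
Qed.

(** * Evaluation of the certificate polynomials at a real point *)

Section Evaluation.
Variables (R : realType) (m n p : nat) (x : 'I_(nvars m n) -> R).

Definition xhat_at (j : 'I_m) : 'cV[R]_n :=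
  \col_i x (lshift (m * n) (lshift m (mxvec_index j i))).
Definition y_at (j : 'I_m) : R := x (lshift (m * n) (rshift (m * n) j)).
Definition z_at (j : 'I_m) : 'cV[R]_n :=
  \col_i x (rshift (m * n + m) (mxvec_index j i)).

Lemma meval_at_xhat j (q : {mpoly R[n]}) : (at_xhat j q).@[x] = peval q (xhat_at j).
Proof.
rewrite /at_xhat comp_mpoly_meval; apply: meval_eq => i.
by rewrite tnth_mktuple !mxE mevalXU.
Qed.

Lemma meval_Yvar j : (Yvar R m n j 0).@[x] = y_at j.
Proof. by rewrite mxE mevalXU. Qed.

Lemma meval_negXiTy (xi : 'I_m -> {mpoly R[n]}) :
  (negXiTy xi).@[x] = - \sum_j y_at j * peval (xi j) (xhat_at j).
Proof.
rewrite /negXiTy mevalN mxE rmorph_sum /=; congr (- _); apply: eq_bigr => j _.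
by rewrite mevalM meval_Yvar !mxE meval_at_xhat mulrC.
Qed.

Lemma meval_ATy (A : 'I_m -> 'rV[{mpoly R[n]}]_p) i :
  (((Apoly A)^T *m Yvar R m n) i 0).@[x] =
  \sum_j y_at j * (mxeval (A j) (xhat_at j)) 0 i.
Proof.
rewrite mxE rmorph_sum /=; apply: eq_bigr => j _.
by rewrite mevalM meval_Yvar !mxE meval_at_xhat mulrC.
Qed.

Lemma meval_ball (V : 'cV[{mpoly R[nvars m n]}]_n) (c : R) :
  (- (V^T *m V) 0 0 + (c ^+ 2)%:MP).@[x] = c ^+ 2 - \sum_i ((V i 0).@[x]) ^+ 2.
Proof.
rewrite mevalD mevalN mevalC mxE rmorph_sum addrC /=; congr (_ - _).
by apply: eq_bigr => i _; rewrite mxE mevalM expr2.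
Qed.

(** [0 < m] makes the block [nseq m] nonempty, so that it expresses the sign of [negXiTy];
    [0 < gamma] turns bounds on squared norms into bounds on norms. *)
Lemma phi_seq_ge0P (xi : 'I_m -> {mpoly R[n]}) hh (gamma : R) (d' : 'I_m -> nat) :
  (0 < m)%N -> 0 < gamma ->
  reflect
    [/\ 0 <= (negXiTy xi).@[x], forall j, 0 <= y_at j,
        forall j, norm2 (z_at j) <= gamma,
        forall j l, norm2 (xhat_at j - xhat_at l) <= gamma &
        forall j d, (d <= d' j)%N -> 0 <= peval (hh d) (xhat_at j)]
    (all (fun f => 0 <= f.@[x]) (phi_seq xi hh gamma d')).
Proof.
move=> m0 g0; rewrite /phi_seq !all_cat all_nseq gtn_eqF //=.
have zE j : (0 <= (- ((Zvar R n j)^T *m Zvar R n j) 0 0 + (gamma ^+ 2)%:MP).@[x]) =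
    (norm2 (z_at j) <= gamma).
  rewrite meval_ball subr_ge0 norm2_le //; congr (_ <= _).
  by apply: eq_bigr => i _; rewrite !mxE mevalXU.
have xE j l : (0 <= (- ((Xhat R n j - Xhat R n l)^T *m (Xhat R n j - Xhat R n l)) 0 0
    + (gamma ^+ 2)%:MP).@[x]) = (norm2 (xhat_at j - xhat_at l) <= gamma).
  rewrite meval_ball subr_ge0 norm2_le //; congr (_ <= _).
  by apply: eq_bigr => i _; rewrite !mxE mevalB !mevalXU.
apply: (iffP and5P) => [[-> /allP yP /allP zP /allP xP /allP hP]|[gx yP zP xP hP]]; split=> //.
- by move=> j; rewrite -meval_Yvar; apply/yP/map_f/mem_enum.
- by move=> j; rewrite -zE; apply/zP/map_f/mem_enum.
- by move=> j l; rewrite -xE; apply: xP; apply: allpairs_f; apply: mem_enum.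
- move=> j d dj; rewrite -meval_at_xhat; apply: hP; apply/flatten_mapP; exists j.
    exact: mem_enum.
  by apply/mapP; exists d; rewrite // mem_iota add0n addn1 ltnS.
- by apply/allP => _ /mapP[j _ ->]; rewrite meval_Yvar.
- by apply/allP => _ /mapP[j _ ->]; rewrite zE.
- by apply/allP => _ /allpairsP[[j l] [_ _ ->]]; rewrite xE.
- apply/allP => _ /flatten_mapP[j _ /mapP[d dj ->]]; rewrite meval_at_xhat; apply: hP.
  by move: dj; rewrite mem_iota add0n addn1 ltnS.
Qed.

End Evaluation.

Definition point (R : realType) (m n : nat) (xhat : 'I_m -> 'cV[R]_n) (y : 'I_m -> R) :
    'I_(nvars m n) -> R :=
  fun v => row_mx (row_mx (mxvec (\matrix_(j, i) xhat j i 0)) (\row_j y j)) 0 0 v.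

Lemma xhat_at_point (R : realType) m n xhat y j : @xhat_at R m n (point xhat y) j = xhat j.
Proof. by apply/colP => i; rewrite mxE /point row_mxEl row_mxEl mxvecE mxE. Qed.

Lemma y_at_point (R : realType) m n xhat y j : @y_at R m n (point xhat y) j = y j.
Proof. by rewrite /y_at /point row_mxEl row_mxEr mxE. Qed.

Lemma z_at_point (R : realType) m n xhat y j : @z_at R m n (point xhat y) j = 0.
Proof. by apply/colP => i; rewrite mxE /point row_mxEr !mxE. Qed.

Lemma phi_mem (R : realType) m n (xi : 'I_m -> {mpoly R[n]}) hh gamma (d' : 'I_m -> nat) f :
  f \in phi_seq xi hh gamma d' <-> exists i, f = phi xi hh gamma (d' := d') i.
Proof.
split=> [|[i ->]]; last by rewrite mem_nth // size_phi_seq.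
move=> /(nthP 0)[i]; rewrite size_phi_seq => lt <-.
by exists (Ordinal lt).
Qed.

Lemma sos_meval_ge0 (R : realType) N (q : {mpoly R[N]}) x : sos q -> 0 <= q.@[x].
Proof.
move=> [l ->]; rewrite rmorph_sum; apply: sumr_ge0 => t _.
by rewrite rmorphXn sqr_ge0.
Qed.

Section Feasibility.
Variables (R : realType) (m n p : nat) (A : 'I_m -> 'rV[{mpoly R[n]}]_p)
  (xi : 'I_m -> {mpoly R[n]}) (hh : nat -> {mpoly R[n]}) (gamma : R) (d' : 'I_m -> nat).
Hypotheses (m0 : (0 < m)%N) (gamma0 : 0 < gamma).
Let ph := @phi R m n xi hh gamma d'.
Let psi i := ((Apoly A)^T *m Yvar R m n) i 0.

Definition feasible : Prop := forall xhat : 'I_m -> 'cV[R]_n,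
  (forall (j : 'I_m) (d : nat), (d <= d' j)%N -> 0 <= peval (hh d) (xhat j)) ->
  (forall j l : 'I_m, norm2 (xhat j - xhat l) <= gamma) ->
  exists u : 'cV[R]_p, forall j : 'I_m,
    (mxeval (A j) (xhat j) *m u) 0 0 <= peval (xi j) (xhat j).

Definition certificate : Prop := exists (rho : 'I_p -> 'I_m -> {mpoly R[nvars m n]})
  (q : {set 'I_(nineq d')} -> {mpoly R[nvars m n]}) (r : 'I_m -> nat),
  (forall S, sos (q S)) /\
  \sum_(S : {set 'I_(nineq d')}) q S * \prod_(i in S) ph i
  + \prod_(j < m) negXiTy xi ^+ (2 * r j)
  + \sum_(j < m) \sum_(i < p) rho i j * psi i = 0.

(** If the multiplier condition of [farkas] failed, the identity evaluated at that multiplier with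
    zero [z] would read: nonnegative plus strictly positive plus zero equals zero. *)
Lemma certificate_feasible : certificate -> feasible.
Proof.
move=> [rho [q [r [qsos cert]]]] xhat hP xP.
have [y y0 yA|u uP] := @farkas R p 'I_m (fun j i => mxeval (A j) (xhat j) 0 i)
    (fun j => peval (xi j) (xhat j)); last first.
  exists (\col_i u i) => j; apply: le_trans (uP j); rewrite mxE.
  by rewrite le_eqVlt; apply/orP; left; apply/eqP/eq_bigr => i _; rewrite [(\col_i _) _ _]mxE.
rewrite leNgt; apply/negP => neg.
pose x := point xhat y.
have gE : (negXiTy xi).@[x] = - \sum_j y j * peval (xi j) (xhat j).
  rewrite meval_negXiTy; congr (- _); apply: eq_bigr => j _.
  by rewrite y_at_point xhat_at_point.
have g0 : 0 < (negXiTy xi).@[x] by rewrite gE oppr_gt0.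
have ph0 i : 0 <= (ph i).@[x].
  have /allP : all (fun f => 0 <= f.@[x]) (phi_seq xi hh gamma d').
    apply/phi_seq_ge0P => //; split=> [|j|j|j l|j d dj].
    - exact: ltW.
    - by rewrite y_at_point.
    - rewrite z_at_point norm2_le // big1 => [|k _]; first exact: sqr_ge0.
      by rewrite mxE expr0n.
    - by rewrite !xhat_at_point.
    - by rewrite xhat_at_point; apply: hP.
  by apply; apply/phi_mem; exists i.
have psi0 i : (psi i).@[x] = 0.
  rewrite meval_ATy -[RHS](yA i); apply: eq_bigr => j _.
  by rewrite y_at_point xhat_at_point.
have := congr1 (meval x) cert; rewrite !mevalD meval0 => E.
suff : 0 < 0 :> R by rewrite ltxx.
rewrite -[X in _ < X]E; apply: ltr_wpDr.
  rewrite rmorph_sum /= big1 // => j _; rewrite rmorph_sum /= big1 // => i _.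
  by rewrite mevalM psi0 mulr0.
apply: ltr_wpDl; last by rewrite rmorph_prod; apply: prodr_gt0 => j _; rewrite rmorphXn exprn_gt0.
rewrite rmorph_sum; apply: sumr_ge0 => S _; rewrite rmorphM; apply: mulr_ge0.
  exact: sos_meval_ge0.
rewrite rmorph_prod; apply: prodr_ge0 => i _; exact: ph0.
Qed.

Lemma feasible_certificate : feasible -> certificate.
Proof.
(* The equations [psi i = 0] enter as pairs of inequalities; the ideal part contains both signs. *)
move=> feas; pose fs := phi_seq xi hh gamma d' ++ [seq psi i | i <- enum 'I_p]
  ++ [seq - psi i | i <- enum 'I_p].
have [r [l [rho E]]] : exists r, cone_plus_ideal ph psi (- negXiTy xi ^+ (2 * r)).
  apply: (@stengle R _ (cone_plus_ideal ph psi) fs).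
  - exact: cone_plus_idealD.
  - exact: cone_plus_idealM.
  - exact: cone_plus_ideal_sq.
  - move=> f; rewrite mem_cat [X in _ || X]mem_cat.
    move=> /or3P[/phi_mem[i ->]|/mapP[i _ ->]|/mapP[i _ ->]].
    + exact: cone_plus_ideal_gen.
    + by rewrite -[psi i]mul1r; apply: cone_plus_ideal_ideal.
    + by rewrite -mulN1r; apply: cone_plus_ideal_ideal.
  move=> x xP.
  have [g0 y0 _ xx hx] : [/\ 0 <= (negXiTy xi).@[x], forall j, 0 <= y_at x j,
      forall j, norm2 (z_at x j) <= gamma,
      forall j l, norm2 (xhat_at x j - xhat_at x l) <= gamma &
      forall j d, (d <= d' j)%N -> 0 <= peval (hh d) (xhat_at x j)].
    by apply/phi_seq_ge0P => //; apply/allP => f fphi; apply: xP; rewrite mem_cat fphi.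
  have psi0 i : (psi i).@[x] = 0.
    apply/eqP; rewrite eq_le -oppr_ge0 -mevalN !xP //.
      by rewrite mem_cat [X in _ || X]mem_cat map_f ?mem_enum ?orbT.
    by rewrite mem_cat [X in _ || X]mem_cat (map_f (fun i => - psi i)) ?mem_enum ?orbT.
  have [u uP] := feas (xhat_at x) hx xx.
  apply/eqP; rewrite eq_le g0 andbT meval_negXiTy oppr_le0.
  (* The easy direction of Farkas: since [A^T y = 0], weighting the constraints on [u] by [y] gives
     [0 <= \sum_j y_j xi_j], while [g0] is the opposite inequality. *)
  have E0 : \sum_j y_at x j * (mxeval (A j) (xhat_at x j) *m u) 0 0 = 0.
    transitivity (\sum_i (psi i).@[x] * u i 0); last first.
      by rewrite big1 // => i _; rewrite psi0 mul0r.
    under eq_bigr do rewrite mxE mulr_sumr.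
    rewrite exchange_big /=; apply: eq_bigr => i _.
    by rewrite meval_ATy mulr_suml; apply: eq_bigr => j _; rewrite mulrA.
  rewrite -[leLHS]E0; apply: ler_sum => j _.
  exact: ler_wpM2l.
(* One exponent and one family of multipliers come out; both are placed at [j0]. The other indices
   get zero multipliers and zero exponents, that is, factors 1. *)
have [j0 _] : exists j : 'I_m, True by exists (Ordinal m0).
exists (fun i j => if j == j0 then rho i else 0),
  (fun S => \sum_(t <- l | t.2 == S) t.1 ^+ 2), (fun j => if j == j0 then r else 0%N).
split=> [S|]; first by exists [seq t.1 | t <- l & t.2 == S]; rewrite big_map big_filter.
rewrite -cone_sum_group (bigD1 j0) //= eqxx big1 => [|j /negPf ->]; last by rewrite muln0.
rewrite mulr1 (bigD1 j0) //= [X in _ + (_ + X)]big1 => [|j /negPf ->]; last first.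
  by apply: big1 => i _; rewrite mul0r.
under [X in _ + (X + _)]eq_bigr do rewrite eqxx.
by rewrite addr0 addrAC -/(ideal_sum psi rho) -E addNr.
Qed.

Lemma feasible_certificateP : feasible <-> certificate.
Proof. by split; [apply: feasible_certificate|apply: certificate_feasible]. Qed.

End Feasibility.

Theorem lemma4 (R : realType) (m n p k w v : nat)
  (F : 'M[R]_n) (G : 'M[R]_(n, p)) (c : 'M[R]_(k, n))
  (sigma : 'M[R]_(n, w)) (nu : 'M[R]_(k, v)) (P : 'M[R]_n) (K : 'M[R]_(n, k))
  (h : {mpoly R[n]}) (gamma : R) (gammas : 'I_m -> R) (d' : 'I_m -> nat)
  (xi : 'I_m -> {mpoly R[n]}) :
  (0 < m)%N ->
  nu *m nu^T \in unitmx ->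
  steady_state_covariance F c sigma nu P ->
  K = kalman_gain c nu P ->
  0 < gamma ->
  (forall j : 'I_m, 0 < gammas j) ->
  (forall j : 'I_m, relative_degree F G sigma h (d' j)) ->
  (forall (j : 'I_m) (d : nat), (d <= d' j)%N ->
     has_sup (hbar_set (hd F G sigma h d) gamma)) ->
  (forall j : 'I_m, has_sup (hbar_set (hd F G sigma h (d' j)) (gammas j))) ->
  (forall (j : 'I_m) (x : 'cV[R]_n),
     peval (xi j) x = xi_fun F c nu K (hd F G sigma h (d' j)) (gammas j) x) ->
  (forall xhat : 'I_m -> 'cV[R]_n,
     (forall (j : 'I_m) (d : nat), (d <= d' j)%N ->
        0 <= peval (hhat (hd F G sigma h d) gamma) (xhat j)) ->
     (forall j l : 'I_m, norm2 (xhat j - xhat l) <= gamma) ->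
     exists u : 'cV[R]_p, forall j : 'I_m,
       (mxeval (Arow G (hd F G sigma h (d' j))) (xhat j) *m u) 0 0
       <= xi_fun F c nu K (hd F G sigma h (d' j)) (gammas j) (xhat j))
  <->
  (exists (rho : 'I_p -> 'I_m -> {mpoly R[nvars m n]})
          (q : {set 'I_(nineq d')} -> {mpoly R[nvars m n]})
          (r : 'I_m -> nat),
     (forall S, sos (q S)) /\
     \sum_(S : {set 'I_(nineq d')})
        q S * \prod_(i in S)
                 phi xi (fun d => hhat (hd F G sigma h d) gamma) gamma i
     + \prod_(j < m) negXiTy xi ^+ (2 * r j)
     + \sum_(j < m) \sum_(i < p)
         rho i j * ((Apoly (fun l => Arow G (hd F G sigma h (d' l))))^T
                    *m Yvar R m n) i 0
     = 0).
Proof.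
move=> m0 _ _ _ gamma0 _ _ _ _ xiP.
rewrite -/(certificate (fun l => Arow G (hd F G sigma h (d' l))) xi
  (fun d => hhat (hd F G sigma h d) gamma) gamma d').
rewrite -feasible_certificateP //.
(* The norm term makes [xi_fun] a function and not a polynomial expression; [xiP] exchanges it
   pointwise with the polynomial [xi]. *)
split=> feas xhat hP xP; have [u uP] := feas xhat hP xP; exists u => j.
  by rewrite xiP.
by rewrite -xiP.
Qed.
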